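(* Let $M$ be a compact separable metric space with Borel $\sigma$-algebra $\mathcal B$, and $\tau:M\to M$ continuous and uniquely ergodic with (unique) invariant Borel probability measure $\mu$. Let $(\Omega,\mathcal F,P)$ be a probability space and $(\theta_k)_{k\in\mathbb{Z}^d}$ a $d$-parameter group of $P$-preserving transformations such that $P$ is strongly mixing with respect to $(\theta_k)_{k\in\mathbb{Z}^d}$. Let $\kappa:M\to\mathbb{Z}^d$ be $\mathcal B$-measurable, $\kappa_n=\sum_{i=0}^{n-1}\kappa\circ\tau^i$, and assume that for all $m\in\mathbb{N}$ $$\lim_{n\to\infty}\frac1{n^2}\sup_{t\in M}\big|\{1\le i,j\le n:\ \|\kappa_i(t)-\kappa_j(t)\|\le m\}\big|=0.$$ Let $1\le p<\infty$. Then for every $\mathcal B\otimes\mathcal F$-measurable function $F$ on $M\times\Omega$ such that $\sup_{t\in M}|F(t,\cdot)|\in L^p(\Omega,\mathcal F,P)$ and $F(\cdot,\omega)$ is continuous on $M$ for $P$-almost every $\omega$, $$\sup_{t\in M}\Big\|\frac1n\sum_{i=0}^{n-1}F\big(\tau^i(t),\theta_{\kappa_i(t)}\,\cdot\,\big)-\bar E[F]\Big\|_{L^p(P)}\to0\quad(n\to\infty),$$ where $\bar E[F]=\int F\,d(\mu\otimes P)$.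
   Context: $\|\cdot\|$ is the maximum norm on $\mathbb{Z}^d$. A $d$-parameter group of $P$-preserving transformations: each $\theta_k$ measurable and $P$-preserving, $\theta_0=\mathrm{Id}$, $\theta_k\circ\theta_l=\theta_{k+l}$, $\theta_{-k}=\theta_k^{-1}$. $P$ is strongly mixing w.r.t. $(\theta_k)$ if $P(A\cap\theta_k^{-1}B)\to P(A)P(B)$ as $\|k\|\to\infty$ for all $A,B\in\mathcal F$. A continuous map of a compact metrizable space is uniquely ergodic if it has exactly one invariant Borel probability measure. *)

(* Defs.v *)
From HB Require Import structures.
From mathcomp Require Import all_boot all_order all_algebra.
From mathcomp Require Import all_classical all_reals all_analysis.
From mathcomp Require Import measurable_realfun.
Set Implicit Arguments. Unset Strict Implicit. Unset Printing Implicit Defensive.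
Import Order.TTheory GRing.Theory Num.Theory.
Import numFieldNormedType.Exports.
Local Open Scope classical_set_scope.
Local Open Scope ring_scope.

Definition borel_of (T : ptopologicalType) : Type :=
  g_sigma_algebraType (@open T).

Definition zmaxnorm (d : nat) (k : 'rV[int]_d) : nat :=
  \max_(i < d) `|k ord0 i|%N.

Definition separable_space (T : topologicalType) : Prop :=
  exists D : set T, countable D /\ closure D = setT.

Definition preserving_group (R : realType) (dO : measure_display)
  (Omega : measurableType dO) (P : probability Omega R) (d : nat)
  (theta : 'rV[int]_d -> Omega -> Omega) : Prop :=
  [/\ (forall k, measurable_fun setT (theta k)),
      (forall k A, measurable A -> P (theta k @^-1` A) = P A),
      theta 0 = id,
      (forall k l, theta (k + l) = theta k \o theta l) &
      (forall k, cancel (theta k) (theta (- k)) /\ cancel (theta (- k)) (theta k))].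

Definition strongly_mixing (R : realType) (dO : measure_display)
  (Omega : measurableType dO) (P : probability Omega R) (d : nat)
  (theta : 'rV[int]_d -> Omega -> Omega) : Prop :=
  forall A B, measurable A -> measurable B ->
    forall eps : R, 0 < eps -> exists N : nat, forall k : 'rV[int]_d,
      (N < zmaxnorm k)%N ->
      `| fine (P (A `&` theta k @^-1` B)) - fine (P A) * fine (P B) | < eps.

Definition invariant_prob (R : realType) (M : ptopologicalType)
  (tau : M -> M) (nu : probability (borel_of M) R) : Prop :=
  forall A : set (borel_of M), measurable A -> nu (tau @^-1` A) = nu A.

Definition uniquely_ergodic_with (R : realType) (M : ptopologicalType)
  (tau : M -> M) (mu : probability (borel_of M) R) : Prop :=
  [/\ continuous tau, invariant_prob tau mu &
      forall nu : probability (borel_of M) R, invariant_prob tau nu ->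
        forall A : set (borel_of M), measurable A -> nu A = mu A].

Definition cocycle (M : Type) (d : nat) (tau : M -> M)
  (kappa : M -> 'rV[int]_d) (n : nat) (t : M) : 'rV[int]_d :=
  \sum_(i < n) kappa (iter i tau t).

Definition close_pairs (M : Type) (d : nat) (tau : M -> M)
  (kappa : M -> 'rV[int]_d) (m n : nat) (t : M) : nat :=
  #|[set ij : 'I_n * 'I_n |
     (zmaxnorm (cocycle tau kappa ij.1.+1 t - cocycle tau kappa ij.2.+1 t)
        <= m)%N]|.

Definition ergodic_avg (R : realType) (M Omega : Type) (d : nat)
  (tau : M -> M) (theta : 'rV[int]_d -> Omega -> Omega)
  (kappa : M -> 'rV[int]_d) (F : M * Omega -> R) (n : nat) (t : M) (w : Omega) : R :=
  (n%:R)^-1 * \sum_(i < n) F (iter i tau t, theta (cocycle tau kappa i t) w).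

(* Main.v *)
(** Unique ergodicity makes the Birkhoff averages of continuous functions
    converge uniformly: otherwise an ultralimit of empirical measures along a
    bad sequence of orbit segments is a finitely additive invariant content,
    which regularizes (inner content on open sets, Caratheodory extension) to
    an invariant Borel probability measure different from [mu].

    On the probability side, the second moment of a weighted average of
    [1_B o theta_(kappa_i(t)) - P B] is a double sum of correlations; strong
    mixing makes those with [|kappa_i(t) - kappa_j(t)|] large small, and the
    sparsity hypothesis says that the other pairs are negligible, uniformly in
    [t].  Layer-cake sums extend this from indicators to bounded functions.

    If [F] is bounded, [t |-> F(t, .)] is continuous into [L^1(P)], hence has a
    finite net, so the centered averages of [F] are controlled by finitely many
    weighted averages, while the means [t |-> E F(t, .)] form a continuous
    function handled by unique ergodicity.  A general [F] is truncated where
    [sup_t |F(t, .)|] exceeds [K]; convexity of [x^p] and invariance of [P]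
    bound the error by the tail of the [p]-th moment, uniformly in [n] and [t]. *)

Require Import Defs.
From HB Require Import structures.
From mathcomp Require Import all_boot all_order all_algebra.
From mathcomp Require Import all_classical all_reals all_analysis.
From mathcomp Require Import measurable_realfun.
From mathcomp Require Import finmap lra ring.
Import Order.TTheory GRing.Theory Num.Theory.
Import numFieldNormedType.Exports.
Local Open Scope classical_set_scope.
Local Open Scope ring_scope.
Set Implicit Arguments. Unset Strict Implicit. Unset Printing Implicit Defensive.

(** * Invariant measures from invariant contents *)

Section shrink.
Context {R : realType} {M : pseudoPMetricType R}.
Implicit Types U C : set M.

(* No distance function is available in a pseudometric structure, only balls:
   [shrink n U] replaces [{x | dist x (~` U) >= n.+1^-1}]. *)
Definition shrink (n : nat) (U : set M) : set M :=
  closure [set x | ball x n.+1%:R^-1 `<=` U].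

Lemma closed_shrink n U : closed (shrink n U).
Proof. exact: closed_closure. Qed.

Lemma shrink_sub n U : shrink n U `<=` U.
Proof.
move=> x clx; have e0 : 0 < n.+1%:R^-1 :> R by rewrite invr_gt0.
have [y [/= yU xy]] := clx _ (nbhsx_ballx x _ e0).
exact/yU/ball_sym.
Qed.

(** Half of a radius that fits in [U] is spent on moving [x], the other half on the ball that
    [shrink] asks for. The joint form in the point and the index is the one used by near-covering
    compactness. *)
Lemma shrink_near U x : open U -> U x ->
  \forall x' \near x & n \near \oo, shrink n U x'.
Proof.
move=> oU Ux; have /nbhs_ballP[e /= e0 eU] : nbhs x U by exact: open_nbhs_nbhs.
exists (ball x (e / 2), [set n | n.+1%:R^-1 < e / 2]) => /=.
  split; first by apply: nbhsx_ballx; rewrite divr_gt0.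
  exact: (near_infty_natSinv_lt (PosNum (divr_gt0 e0 (ltr0Sn R 1)))).

move=> [y n] /= [xy ne]; apply: subset_closure => z yz; apply: eU.
rewrite (splitr e); apply: ball_triangle xy _.
exact: le_ball (ltW ne) _ yz.
Qed.

End shrink.

Section outer_of_content.
Context {R : realType} {M : pseudoPMetricType R} (cM : compact [set: M]).
Context (lam : set M -> R) (lam_ge0 : forall A, 0 <= lam A)
  (lamU : forall A B, A `&` B = set0 -> lam (A `|` B) = lam A + lam B).
Implicit Types A B C U V : set M.

Lemma content0 : lam set0 = 0.
Proof.
have := @lamU set0 set0; rewrite setI0 setU0 => /(_ erefl) h; lra.
Qed.

Lemma le_content A B : A `<=` B -> lam A <= lam B.
Proof.
move=> AB; have -> : B = A `|` (B `\` A) by rewrite setDUK.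
by rewrite lamU ?lerDl// setDIK.
Qed.

Lemma content_le_sum A (B : nat -> set M) n :
  (forall x, A x -> exists2 i, (i < n)%N & B i x) ->
  lam A <= \sum_(i < n) lam (B i).
Proof.
elim: n A => [|n ih] A hA.
  rewrite big_ord0 -content0; apply: le_content => x /hA[//].
rewrite big_ord_recr/= -(setUIDK A (~` B n)) lamU; last by rewrite -subset0 => x [[_ ?] []].
rewrite lerD//.
  apply: ih => x [/hA[i]]; rewrite ltnS leq_eqVlt => /predU1P[->//|*]; by exists i.
by apply: le_content => x [_ /contrapT].
Qed.

(** A finitely additive [lam] may lose mass in countable limits. Testing open sets by closed
    subsets, which are compact here, restores countable subadditivity. *)
Definition inner_content U : \bar R :=
  ereal_sup [set (lam C)%:E | C in [set C | closed C /\ C `<=` U]].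

(** The outer regular extension from open sets, as in the Riesz representation theorem. *)
Definition outer_content A : \bar R :=
  ereal_inf [set inner_content U | U in [set U | open U /\ A `<=` U]].

Lemma content_le_inner C U : closed C -> C `<=` U ->
  ((lam C)%:E <= inner_content U)%E.
Proof. by move=> cC CU; apply: ereal_sup_ubound; exists C. Qed.

Lemma inner_content_ge0 U : (0 <= inner_content U)%E.
Proof.
apply: le_trans (content_le_inner closed0 (sub0set U)).
by rewrite content0.
Qed.

Lemma le_inner_content U V : U `<=` V -> (inner_content U <= inner_content V)%E.
Proof.
move=> UV; apply: ge_ereal_sup => _ [C [cC CU] <-].
have CV : C `<=` V by exact: subset_trans UV.
exact: content_le_inner.
Qed.

Lemma inner_content_le U : (inner_content U <= (lam U)%:E)%E.
Proof.
by apply: ge_ereal_sup => _ [C [cC CU] <-]; rewrite lee_fin le_content.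
Qed.

Lemma inner_content_fin U : inner_content U \is a fin_num.
Proof.
rewrite ge0_fin_numE ?inner_content_ge0//.
exact: le_lt_trans (inner_content_le U) (ltry _).
Qed.

(** Compactness of [C], with closed shrunken sets in place of the open ones, because [inner_content]
    only sees closed subsets. A single [n] bounds both the number of sets and the shrinking
    level. *)
Lemma closed_finite_shrink C (U : nat -> set M) : closed C ->
  (forall n, open (U n)) -> C `<=` \bigcup_n U n ->
  exists n, forall x, C x -> exists2 i, (i < n)%N & shrink n (U i) x.
Proof.
move=> cC oU CU.
have /compact_near_coveringP/near_covering_withinP cvC : compact C.
  exact: subclosed_compact cC cM (@subsetT _ C).
have /= := cvC nat (\oo : set_system nat) (fun n x => exists2 i, (i < n)%N & shrink n (U i) x) _.
move=> []//.
  move=> x /CU[i _ Uix].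
  have := shrink_near (oU i) Uix.
  move=> [[/= A N] [nA nN] AN].
  exists (A, N `&` [set n | (i < n)%N]) => /=.
    by split => //; apply: filterI => //; exists i.+1.
  by move=> [y n] /= [Ay [Nn ni]] Cy; exists i => //; apply: (AN (y, n)).
by move=> n _ /(_ n (leqnn _)) h; exists n.
Qed.

Lemma inner_content_bigcup (U : nat -> set M) : (forall n, open (U n)) ->
  (inner_content (\bigcup_n U n) <= \sum_(n <oo) inner_content (U n))%E.
Proof.
move=> oU; apply: ge_ereal_sup => _ [C [cC CU] <-].
have [n Cn] := closed_finite_shrink cC oU CU.
have le1 : ((lam C)%:E <= \sum_(i < n) inner_content (U i))%E.
  apply: (@le_trans _ _ (\sum_(i < n) (lam (shrink n (U i)))%:E)%E).
    rewrite sumEFin lee_fin.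
    exact: (content_le_sum (B := fun i => shrink n (U i))).
  apply: lee_sum => i _; apply: content_le_inner.
    exact: closed_shrink.
  exact: shrink_sub.
apply: le_trans le1 _; rewrite -(big_mkord xpredT (fun i => inner_content (U i))).
by apply: nneseries_lim_ge => *; exact: inner_content_ge0.
Qed.

Lemma outer_content_open U : open U -> outer_content U = inner_content U.
Proof.
move=> oU; apply/eqP; rewrite eq_le; apply/andP; split.
  by apply: ereal_inf_lbound; exists U => //; split.
by apply: le_ereal_inf_tmp => _ [V [oV UV] <-]; exact: le_inner_content.
Qed.

Lemma outer_content0 : outer_content set0 = 0%E.
Proof.
rewrite outer_content_open; last exact: open0.
apply/eqP; rewrite eq_le inner_content_ge0 andbT.
by apply: le_trans (inner_content_le _) _; rewrite content0.
Qed.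

Lemma outer_content_ge0 A : (0 <= outer_content A)%E.
Proof.
by apply: le_ereal_inf_tmp => _ [V _ <-]; exact: inner_content_ge0.
Qed.

Lemma le_outer_content : {homo outer_content : A B / A `<=` B >-> (A <= B)%E}.
Proof.
move=> A B AB; apply: ereal_inf_le_tmp => _ [V [oV BV] <-].
exists V => //; split => //.
exact: subset_trans BV.
Qed.

Lemma outer_content_fin A : outer_content A \is a fin_num.
Proof.
rewrite ge0_fin_numE ?outer_content_ge0//.
apply: le_lt_trans (le_outer_content (@subsetT _ A)) _.
rewrite outer_content_open; last exact: openT.
exact: le_lt_trans (inner_content_le _) (ltry _).
Qed.

Lemma outer_content_adherent A (e : R) : 0 < e ->
  exists U, [/\ open U, A `<=` U & (inner_content U < outer_content A + e%:E)%E].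
Proof.
move=> e0; have [_ [U [oU AU] <-] h] := lb_ereal_inf_adherent e0 (outer_content_fin A).
by exists U.
Qed.

Lemma inner_content_adherent U (e : R) : 0 < e ->
  exists C, [/\ closed C, C `<=` U & (inner_content U - e%:E < (lam C)%:E)%E].
Proof.
move=> e0; have [_ [C [cC CU] <-] h] := ub_ereal_sup_adherent e0 (inner_content_fin U).
by exists C.
Qed.

Lemma outer_content_sigma_subadditive : sigma_subadditive outer_content.
Proof.
move=> A; apply/lee_addgt0Pr => e e0.
apply: (le_trans _ (epsilon_trick _ _ _)); last 2 first.
- by move=> n; exact: outer_content_ge0.
- exact: ltW.
have [U hU] : {U : nat -> set M & forall n, [/\ open (U n), A n `<=` U n &
    (inner_content (U n) < outer_content (A n) + (e / (2 ^ n.+1)%:R)%:E)%E]}.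
  apply: (@choice _ _ (fun n U => [/\ open U, A n `<=` U &
    (inner_content U < outer_content (A n) + (e / (2 ^ n.+1)%:R)%:E)%E])) => n.
  by apply: outer_content_adherent; rewrite divr_gt0// ltr0n expn_gt0.
apply: (@le_trans _ _ (inner_content (\bigcup_n U n))).
  apply: ereal_inf_lbound; exists (\bigcup_n U n) => //; split.
    by apply: bigcup_open => n _; have [] := hU n.
  by apply: subset_bigcup => n _; have [] := hU n.
apply: le_trans (inner_content_bigcup _) _.
  by move=> n; have [] := hU n.
apply: lee_nneseries => n *; first exact: inner_content_ge0.
by have [_ _ /ltW] := hU n.
Qed.

HB.instance Definition _ := isOuterMeasure.Build R M outer_content
  outer_content0 outer_content_ge0 le_outer_content
  outer_content_sigma_subadditive.

Lemma content_le_outer C : closed C -> ((lam C)%:E <= outer_content C)%E.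
Proof.
by move=> cC; apply: le_ereal_inf_tmp => _ [V [oV BV] <-]; exact: content_le_inner.
Qed.

(** Inside an almost optimal open [V] around [X], two disjoint closed sets [K] and [K'] nearly
    exhaust the parts of [V] that cover [X] inside and outside [U]; additivity of [lam] on [K] and
    [K'] then splits the content of [V]. *)
Lemma open_caratheodory U : open U -> outer_content.-caratheodory U.
Proof.
move=> oU; apply: le_caratheodory_measurable => X.
change (outer_content (X `&` U) + outer_content (X `&` ~` U) <= outer_content X)%E.
apply/lee_addgt0Pr => e e0.
have e30 : 0 < e / 3 by rewrite divr_gt0.
have [V [oV XV hV]] := outer_content_adherent X e30.
have [K [cK KVU hK]] := inner_content_adherent (V `&` U) e30.
(* Removing [K] rather than [U] from [V] leaves an open set, which still contains [X] minus [U]. *)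
have [K' [cK' KVU' hK']] := inner_content_adherent (V `\` K) e30.
have oVK : open (V `\` K) by apply: openI => //; exact: closed_openC.
have h1 : (outer_content (X `&` U) <= inner_content (V `&` U))%E.
  rewrite -outer_content_open; last exact: openI.
  by apply: le_outer_content; apply: setSI.
have h2 : (outer_content (X `&` ~` U) <= inner_content (V `\` K))%E.
  rewrite -outer_content_open//.
  apply: le_outer_content => x [/XV Vx nUx]; split => // /KVU[_]; exact: nUx.
have h3 : ((lam K)%:E + (lam K')%:E <= inner_content V)%E.
  rewrite -EFinD -lamU; last first.
    by rewrite -subset0 => x [Kx /KVU'[_]].
  apply: content_le_inner; first exact: closedU.
  by move=> x [/KVU[]|/KVU'[]].
move: h1 h2 h3 hV hK hK'.
rewrite -(fineK (outer_content_fin X)) -(fineK (outer_content_fin (X `&` U))).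
rewrite -(fineK (outer_content_fin (X `&` ~` U))).
rewrite -(fineK (inner_content_fin V)) -(fineK (inner_content_fin (V `&` U))).
rewrite -(fineK (inner_content_fin (V `\` K))).
rewrite -!EFinN -!EFinD !lee_fin !lte_fin; lra.
Qed.

Lemma borel_caratheodory (A : set (borel_of M)) :
  measurable A -> outer_content.-caratheodory A.
Proof.
move: A; apply: smallest_sub => [|U]; last exact: open_caratheodory.
split.
- exact: (caratheodory_measurable_set0 outer_content).
- by move=> A mA; rewrite setTD; exact: (@caratheodory_measurable_setC _ _ outer_content).
- exact: (@caratheodory_measurable_bigcup _ _ outer_content).
Qed.

(** A copy of [outer_content] typed on [borel_of M], so that it can carry a measure structure beside
    the outer measure structure of the original. *)
Definition content_measure (A : set (borel_of M)) : \bar R := outer_content A.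

Let content_measure_sigma_additive : semi_sigma_additive content_measure.
Proof.
move=> F mF tF mUF.
apply: (@caratheodory_measure_sigma_additive R M outer_content F) => //.
- by move=> i; exact: borel_caratheodory.
- exact: borel_caratheodory.
Qed.

HB.instance Definition _ := isMeasure.Build _ (borel_of M) R content_measure
  outer_content0 outer_content_ge0 content_measure_sigma_additive.

Hypothesis lamT : lam setT = 1.

Let content_measureT : content_measure setT = 1%E.
Proof.
apply/eqP; rewrite eq_le; apply/andP; split.
  rewrite /content_measure outer_content_open; last exact: openT.
  by apply: le_trans (inner_content_le _) _; rewrite lamT.
by rewrite -lamT; apply: content_le_outer; exact: closedT.
Qed.

HB.instance Definition _ :=
  Measure_isProbability.Build _ _ _ content_measure content_measureT.

Lemma exists_prob_of_content : exists nu : probability (borel_of M) R,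
  forall A, nu A = outer_content A.
Proof. by exists content_measure. Qed.

(** A closed [C] inside the preimage of an open [V] has a compact, hence closed, image inside [V],
    and [C] lies in the preimage of that image, where invariance of [lam] applies. *)
Lemma outer_content_preimage (tau : M -> M) A : hausdorff_space M ->
  continuous tau -> (forall B, lam (tau @^-1` B) = lam B) ->
  (outer_content (tau @^-1` A) <= outer_content A)%E.
Proof.
move=> hM ctau lamtau; apply: le_ereal_inf_tmp => _ [V [oV AV] <-].
apply: (@le_trans _ _ (inner_content (tau @^-1` V))).
  rewrite -outer_content_open; last by move/continuousP: ctau; exact.
  by apply: le_outer_content; exact: preimage_subset.
apply: ge_ereal_sup => _ [C [cC CV] <-].
have cK : compact (tau @` C).
  apply: continuous_compact; first exact: continuous_subspaceT.
  exact: subclosed_compact cC cM (@subsetT _ C).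
apply: (@le_trans _ _ (lam (tau @` C))%:E).
  by rewrite -(lamtau (tau @` C)) lee_fin; apply: le_content => x Cx; exists x.
apply: content_le_inner; first exact: compact_closed.
by move=> _ [x Cx <-]; exact: CV.
Qed.

(** Regularization can only add mass to closed sets, as in the closed-set half of the portmanteau
    theorem; this one-sided comparison is what the ergodic argument uses. *)
Lemma exists_invariant_prob_of_content (tau : M -> M) : hausdorff_space M ->
  continuous tau -> (forall B, lam (tau @^-1` B) = lam B) ->
  exists2 nu : probability (borel_of M) R, invariant_prob tau nu &
    forall C, closed C -> ((lam C)%:E <= nu C)%E.
Proof.
move=> hM ctau lamtau; have [nu nuE] := exists_prob_of_content.
exists nu; last by move=> C cC; rewrite nuE; exact: content_le_outer.
have mtau : measurable_fun [set: borel_of M] (tau : borel_of M -> borel_of M).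
  apply: (@measurability _ _ (borel_of M) (borel_of M) setT _ (@open M)) => //.
  move=> _ [B oB <-]; rewrite setTI; apply: sub_sigma_algebra.
  by move/continuousP: ctau; exact.
have le_nu A : (nu (tau @^-1` A) <= nu A)%E.
  by rewrite !nuE; exact: outer_content_preimage.
move=> A mA; apply/eqP; rewrite eq_le le_nu/=.
have mtA : measurable (tau @^-1` A : set (borel_of M)).
  by rewrite -[X in measurable X]setTI; exact: mtau.
(* The one-sided bound for the complement is the reverse bound for [A], the total mass being 1. *)
have := le_nu (~` A); rewrite preimage_setC !probability_setC//.
rewrite -(fineK (fin_num_measure nu _ mA)) -(fineK (fin_num_measure nu _ mtA)).
by rewrite -!EFinB !lee_fin; lra.
Qed.

End outer_of_content.

(** * Layer-cake approximation *)

Section layer_cake.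
Context {R : realType} (h : R) (h0 : 0 < h).
Implicit Types (y : R) (m : nat).

(** For [0 <= y] this is the minimum of [m] and the integer part of [y / h]. Written as a sum over
    thresholds, it turns into a sum of indicators of superlevel sets when [y] is the value of a
    function. *)
Definition layers m y : R := \sum_(j < m) (j.+1%:R * h <= y)%R%:R.

Let layers_full m y : m.+1%:R * h <= y -> layers m.+1 y = m.+1%:R.
Proof.
move=> my; rewrite /layers (eq_bigr (fun=> 1)) ?sumr_const ?card_ord// => j _.
suff -> : j.+1%:R * h <= y by [].
by apply: le_trans my; rewrite ler_pM2r// ler_nat.
Qed.

Lemma layers_le m y : 0 <= y -> h * layers m y <= y.
Proof.
move=> y0; elim: m => [|m ih]; first by rewrite /layers big_ord0 mulr0.
have [my|my] := leP (m.+1%:R * h) y; first by rewrite layers_full// mulrC.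
by rewrite /layers big_ord_recr/= (lt_geF my) addr0.
Qed.

Lemma layers_ge m y : y <= m.+1%:R * h -> y <= h + h * layers m y.
Proof.
elim: m => [|m ih] ym; first by rewrite /layers big_ord0; lra.
have [my|my] := leP (m.+1%:R * h) y.
  by rewrite layers_full//; apply: le_trans ym _; rewrite -[m.+2%:R]natr1; lra.
by rewrite /layers big_ord_recr/= (lt_geF my) addr0; apply: ih; exact: ltW.
Qed.

End layer_cake.

(** * Limits along ultrafilters *)

Section ultralimit.
Context {R : realType} (F : set_system nat) (UF : UltraFilter F).

(** The image of [F] under [x] is an ultrafilter that contains a compact interval, so it has a limit
    there. *)
Lemma ultra_cvg_bounded (x : nat -> R) (K : R) :
  (forall n, `|x n| <= K) -> cvg (x n @[n --> F]).
Proof.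
move=> xK.
have : UltraFilter (x n @[n --> F]).
  split; first exact: fmap_proper_filter.
  move=> G PG sG; rewrite predeqE => A; split; last exact: sG.
  move=> GA; have [//|nA] := in_ultra_setVsetC (x @^-1` A) UF.
  have /(filterI GA) : G (~` A) by apply: sG.
  by rewrite setICr => /filter_not_empty.
move=> Ux; have : compact `[- K, K]%classic by exact: segment_compact.
rewrite compact_ultra => /(_ _ Ux)[|l [_ xl]]; last first.
  by apply/cvg_ex; exists l.
apply: (@filterE _ F) => n; rewrite /= in_itv/= -ler_norml; exact: xK.
Qed.

End ultralimit.

(** * Bounded measurable functions *)

Section bounded_measurable.
Context {R : realType} {d : measure_display} {T : measurableType d}.
Implicit Types f g : T -> R.

(** With a bound at every point, sums, products and compositions stay in the class, and each member
    is integrable for every probability. *)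
Definition bmfun f := measurable_fun setT f /\ exists K, forall x, `|f x| <= K.

Lemma bmfun_cst (c : R) : bmfun (fun=> c).
Proof. by split; [exact: measurable_cst | exists `|c|]. Qed.

Lemma bmfunD f g : bmfun f -> bmfun g -> bmfun (fun x => f x + g x).
Proof.
move=> [mf [K fK]] [mg [L gL]]; split; first exact: measurable_funD.
by exists (K + L) => x; apply: le_trans (ler_normD _ _) _; rewrite lerD.
Qed.

Lemma bmfunM f g : bmfun f -> bmfun g -> bmfun (fun x => f x * g x).
Proof.
move=> [mf [K fK]] [mg [L gL]]; split; first exact: measurable_funM.
by exists (K * L) => x; rewrite normrM ler_pM.
Qed.

Lemma bmfunZ (c : R) f : bmfun f -> bmfun (fun x => c * f x).
Proof. by move=> bf; apply: bmfunM => //; exact: bmfun_cst. Qed.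

Lemma bmfunB f g : bmfun f -> bmfun g -> bmfun (fun x => f x - g x).
Proof.
move=> bf bg; apply: bmfunD => //; rewrite (_ : (fun x => - g x) = fun x => -1 * g x).
  exact: bmfunZ.
by apply/funext => x; rewrite mulN1r.
Qed.

Lemma bmfun_norm f : bmfun f -> bmfun (fun x => `|f x|).
Proof.
move=> [mf [K fK]]; split; first exact: measurableT_comp.
by exists K => x; rewrite normr_id.
Qed.

Lemma bmfun_sum (I : Type) (s : seq I) (f : I -> T -> R) :
  (forall i, bmfun (f i)) -> bmfun (fun x => \sum_(i <- s) f i x).
Proof.
move=> bf; elim: s => [|i s ih].
  by under eq_fun do rewrite big_nil; exact: bmfun_cst.
by under eq_fun do rewrite big_cons; exact: bmfunD.
Qed.

Lemma bmfun_indic (A : set T) : measurable A -> bmfun (\1_A : T -> R).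
Proof.
move=> mA; split; first exact: measurable_indic.
by exists 1 => x; rewrite indicE; case: (x \in A); rewrite ?normr1 ?normr0.
Qed.

Lemma bmfun_comp (g : T -> T) f : measurable_fun setT g -> bmfun f ->
  bmfun (fun x => f (g x)).
Proof.
move=> mg [mf [K fK]]; split; last by exists K.
exact: measurableT_comp.
Qed.

Context (P : probability T R).

Lemma bmfun_integrable f : bmfun f -> P.-integrable setT (EFin \o f).
Proof.
move=> [mf [K fK]]; apply: measurable_bounded_integrable => //.
  by apply: le_lt_trans (probability_le1 P _) (ltry 1).
exists K; split; first exact: num_real.
by move=> L KL x _ /=; apply: le_trans (fK x) (ltW KL).
Qed.

Lemma mean_cst (c : R) : \int[P]_x c = c.
Proof. by rewrite Rintegral_cst// [X in fine X](_ : _ = 1%E) ?mulr1//; exact: probability_setT. Qed.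

Lemma meanD f g : bmfun f -> bmfun g ->
  \int[P]_x (f x + g x) = \int[P]_x f x + \int[P]_x g x.
Proof. by move=> bf bg; rewrite RintegralD//; exact: bmfun_integrable. Qed.

Lemma meanB f g : bmfun f -> bmfun g ->
  \int[P]_x (f x - g x) = \int[P]_x f x - \int[P]_x g x.
Proof. by move=> bf bg; rewrite RintegralB//; exact: bmfun_integrable. Qed.

Lemma meanZ (c : R) f : bmfun f -> \int[P]_x (c * f x) = c * \int[P]_x f x.
Proof. by move=> bf; rewrite RintegralZl//; exact: bmfun_integrable. Qed.

Lemma mean_sum (I : Type) (s : seq I) (f : I -> T -> R) :
  (forall i, bmfun (f i)) ->
  \int[P]_x (\sum_(i <- s) f i x) = \sum_(i <- s) \int[P]_x f i x.
Proof.
move=> bf; elim: s => [|i s ih].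
  by rewrite big_nil; under eq_Rintegral do rewrite big_nil; rewrite mean_cst.
rewrite big_cons -ih -meanD//; last exact: bmfun_sum.
by under eq_Rintegral do rewrite big_cons.
Qed.

Lemma le_mean f g : bmfun f -> bmfun g -> (forall x, f x <= g x) ->
  \int[P]_x f x <= \int[P]_x g x.
Proof. by move=> bf bg fg; rewrite le_Rintegral//; exact: bmfun_integrable. Qed.

Lemma le_norm_mean f : bmfun f -> `|\int[P]_x f x| <= \int[P]_x `|f x|.
Proof. by move=> bf; rewrite le_normr_Rintegral//; exact: bmfun_integrable. Qed.

Lemma mean_le_cst f (c : R) : bmfun f -> (forall x, f x <= c) -> \int[P]_x f x <= c.
Proof.
move=> bf fc; rewrite -[leRHS](mean_cst c); apply: le_mean => //; exact: bmfun_cst.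
Qed.

Lemma mean_norm_ge0 f : 0 <= \int[P]_x `|f x|.
Proof. exact: Rintegral_ge0. Qed.

Lemma mean_indic (A : set T) : measurable A -> \int[P]_x \1_A x = fine (P A).
Proof. by move=> mA; rewrite /Rintegral integral_indic// setIT. Qed.

Lemma mean_comp (g : T -> T) f : measurable_fun setT g ->
  (forall A, measurable A -> P (g @^-1` A) = P A) -> bmfun f ->
  \int[P]_x f (g x) = \int[P]_x f x.
Proof.
move=> mg Pg bf; rewrite /Rintegral; congr fine.
have mf : measurable_fun setT (EFin \o f) by apply/measurable_EFinP; case: bf.
have ip : P.-integrable (g @^-1` setT) (EFin \o f \o g).
  by rewrite preimage_setT; apply: (bmfun_integrable (bmfun_comp mg bf)).
have := integral_pushforward mg mf ip measurableT; rewrite preimage_setT => /= <-.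
apply: eq_measure_integral => A mA _; exact: Pg.
Qed.

End bounded_measurable.

(** * Uniform convergence of Birkhoff averages *)

Section orbit_average.
Context {R : realType} {M : Type} (tau : M -> M).
Implicit Types f g : M -> R.

Definition orbit_avg f (n : nat) (t : M) : R :=
  n%:R^-1 * \sum_(i < n) f (iter i tau t).

Lemma orbit_avgD f g n t :
  orbit_avg (fun x => f x + g x) n t = orbit_avg f n t + orbit_avg g n t.
Proof. by rewrite /orbit_avg big_split/= mulrDr. Qed.

Lemma orbit_avgZ c f n t :
  orbit_avg (fun x => c * f x) n t = c * orbit_avg f n t.
Proof. by rewrite /orbit_avg -mulr_sumr mulrCA. Qed.

Lemma orbit_avg_sum (I : Type) (s : seq I) (f : I -> M -> R) n t :
  orbit_avg (fun x => \sum_(i <- s) f i x) n t = \sum_(i <- s) orbit_avg (f i) n t.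
Proof. by rewrite /orbit_avg exchange_big/= mulr_sumr. Qed.

Lemma le_orbit_avg f g n t : (forall x, f x <= g x) ->
  orbit_avg f n t <= orbit_avg g n t.
Proof.
by move=> fg; rewrite /orbit_avg ler_wpM2l ?invr_ge0// ler_sum.
Qed.

Lemma orbit_avg_cst c n t : (0 < n)%N -> orbit_avg (fun=> c) n t = c.
Proof.
move=> n0; rewrite /orbit_avg sumr_const card_ord -[c *+ n]mulr_natl mulKf//.
by rewrite pnatr_eq0 -lt0n.
Qed.

Lemma norm_orbit_avg_le f K n t : 0 <= K -> (forall x, `|f x| <= K) ->
  `|orbit_avg f n t| <= K.
Proof.
(* The inverse of 0 is 0, so the empty average is 0; this is where [0 <= K] enters. *)
move=> K0 fK; case: n => [|n]; first by rewrite /orbit_avg invr0 mul0r normr0.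
rewrite ler_norml -[X in - X](orbit_avg_cst K t (ltn0Sn n)) -mulN1r -orbit_avgZ.
rewrite -[X in _ && (_ <= X)](orbit_avg_cst K t (ltn0Sn n)).
apply/andP; split; apply: le_orbit_avg => x; have := fK x; rewrite ler_norml => /andP[].
  by rewrite mulN1r.
by [].
Qed.

(** The sum telescopes. For bounded [f] the difference is of order [1 / n], which makes limits of
    empirical averages invariant. *)
Lemma orbit_avg_shift f n t :
  orbit_avg (f \o tau) n t - orbit_avg f n t = n%:R^-1 * (f (iter n tau t) - f t).
Proof.
rewrite /orbit_avg -mulrBr; congr (_ * _).
case: n => [|n]; first by rewrite !big_ord0 !subrr.
rewrite big_ord_recr/= [in X in _ - X]big_ord_recl/=.
rewrite [X in _ - (_ + X)](eq_bigr (fun i : 'I_n => f (tau (iter i tau t))))//.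
ring.
Qed.

End orbit_average.

Section uniform_ergodic.
Context {R : realType} {M : pseudoPMetricType R}.
Context (hM : hausdorff_space M) (cM : compact [set: M]).

Lemma continuous_bounded (f : M -> R) : continuous f ->
  exists2 K, 0 <= K & forall x, `|f x| <= K.
Proof.
move=> cf; have /compact_bounded[K [_ fK]] : compact (f @` setT).
  by apply: continuous_compact => //; exact: continuous_subspaceT.
exists (`|K| + 1) => [|x]; first by rewrite addr_ge0.
apply: fK; last by exists x.
by rewrite (le_lt_trans (ler_norm K))// ltrDl.
Qed.

Lemma continuous_bmfun (f : M -> R) : continuous f -> @bmfun R _ (borel_of M) f.
Proof.
move=> cf; split; last by have [K _ fK] := continuous_bounded cf; exists K.
apply: (measurability _ (RGenOpens.measurableE R)) => _ [_ [a [b ->]] <-].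
rewrite setTI; apply: sub_sigma_algebra; move/continuousP : cf; apply.
exact: interval_open.
Qed.

Context (tau : M -> M) (mu : probability (borel_of M) R).
Context (ue : uniquely_ergodic_with tau mu).

(** Only the upper bound is accessible directly: the measure built from a content dominates it on
    closed sets, and the superlevel sets of a continuous [f] are closed. Nonnegativity allows the
    layer-cake sum. *)
Let uniform_upper_ge0 (f : M -> R) (e : R) : continuous f ->
  (forall x, 0 <= f x) -> 0 < e ->
  exists N, forall n t, (N <= n)%N ->
    orbit_avg tau f n t <= \int[mu]_x f x + e.
Proof.
have [ctau _ uniq] := ue.
move=> cf f0 e0; apply: contrapT => /forallNP H.
(* Orbit segments violating the bound, the [k]-th of length at least [k.+1]. *)
have [nt Hnt] : {nt : nat -> nat * M & forall k, (k.+1 <= (nt k).1)%N /\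
    \int[mu]_x f x + e < orbit_avg tau f (nt k).1 (nt k).2}.
  apply: (@choice _ _ (fun k (z : nat * M) => (k.+1 <= z.1)%N /\
    \int[mu]_x f x + e < orbit_avg tau f z.1 z.2)) => k.
  have /existsNP[n /existsNP[t /not_implyP[kn /negP]]] := H k.+1.
  by rewrite -ltNge => hn; exists (n, t).
have [U [UU ooU]] := ultraFilterLemma eventually_filter.
have PU : ProperFilter U by exact: ultra_proper.
(* The frequency of visits to [A] along the [k]-th bad segment; its limit along [U] will be the
   content. *)
pose a (A : set M) k := orbit_avg tau (\1_A : M -> R) (nt k).1 (nt k).2.
have indic01 (A : set M) x : 0 <= (\1_A x : R) <= 1.
  by rewrite indicE; case: (x \in A); rewrite ?lexx ?ler01.
have n0 k : (0 < (nt k).1)%N by apply: leq_ltn_trans (Hnt k).1.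
have cva A : cvg (a A k @[k --> U]).
  apply: (ultra_cvg_bounded _ (K := 1)) => k.
  apply: norm_orbit_avg_le => // x.
  by have /andP[? ?] := indic01 A x; rewrite ger0_norm.
pose lam A := lim (a A k @[k --> U]).
have lamE A (l : R) : a A k @[k --> U] --> l -> lam A = l.
  by move=> /cvg_lim; apply.
have lam_ge0 A : 0 <= lam A.
  apply: limr_ge (cva A) _; apply: filterE => k.
  rewrite -(orbit_avg_cst tau 0 (nt k).2 (n0 k)); apply: le_orbit_avg => x.
  by have /andP[] := indic01 A x.
have lamU A B : A `&` B = set0 -> lam (A `|` B) = lam A + lam B.
  move=> AB; apply: lamE.
  rewrite (_ : (fun k => _) = fun k => a A k + a B k).
    by apply: cvgD; exact: cva.
  apply/funext => k; rewrite /a -orbit_avgD; congr orbit_avg.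
  apply/funext => x; rewrite !indicE in_setU.
  case: (boolP (x \in A)) (boolP (x \in B)) => [xA|_] [xB|_]; rewrite /= ?addr0 ?add0r//.
  by have : (A `&` B) x; [split; exact: set_mem|rewrite AB].
have lamT : lam setT = 1.
  apply: lamE; rewrite (_ : (fun k => _) = fun=> 1); first exact: cvg_cst.
  by apply/funext => k; rewrite /a indicT orbit_avg_cst.
have lamtau B : lam (tau @^-1` B) = lam B.
  apply: lamE; rewrite (_ : (fun k => _) = fun k => a B k + (a (tau @^-1` B) k - a B k)).
    rewrite -[X in _ --> X]addr0; apply: cvgD; first exact: cva.
    (* [U] refines the filter at infinity, so it is enough that the difference is at most [1 / k.+1]
       in absolute value. *)
    apply: (@cvg_trans _ ((a (tau @^-1` B) k - a B k) @[k --> \oo])).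
      by apply: cvg_fmap2.
    apply/norm_cvg0P; apply: (@squeeze_cvgr _ _ _ _ (fun=> 0) (fun k => k.+1%:R^-1)).
    - near=> k; rewrite normr_ge0/= orbit_avg_shift normrM ger0_norm ?invr_ge0//.
      rewrite -[leRHS]mulr1; apply: ler_pM => //.
        by rewrite lef_pV2 ?posrE ?ltr0n// ler_nat; case: (Hnt k).
      have := indic01 B (iter (nt k).1 tau (nt k).2).
      by have := indic01 B (nt k).2; rewrite ler_norml; lra.
    - exact: cvg_cst.
    - exact: cvg_harmonic.
  by apply/funext => k; ring.
have [nu inv_nu lamnu] :=
  exists_invariant_prob_of_content cM lam_ge0 lamU lamT hM ctau lamtau.
have [K K0 fK] := continuous_bounded cf.
pose h := e / 2; have h0 : 0 < h by rewrite divr_gt0.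
(* Enough layers of height [h] to reach the bound [K] of [f]. *)
pose m := (Num.truncn (K / h)).+1.
have fm x : f x <= m.+1%:R * h.
  apply: le_trans (ler_norm _) _; apply: le_trans (fK x) _.
  rewrite -ler_pdivrMr//; apply: ltW; apply: lt_trans (truncnS_gt _) _.
  by rewrite ltr_nat.
pose C j := [set x | j.+1%:R * h <= f x].
have layersE x : layers h m (f x) = \sum_(j < m) \1_(C j) x.
  by apply: eq_bigr => j _; rewrite indicE; congr (nat_of_bool _)%:R; apply/idP/idP => [?|/set_mem]; first exact: mem_set.
have cC j : closed (C j).
  by apply: (preimage_closed (f := f) (D := [set y | _ <= y])) => [x _|]; [exact: cf|exact: closed_ge].
have bC j : @bmfun R _ (borel_of M) (\1_(C j)).
  apply: bmfun_indic; rewrite -[C j]setCK; apply: measurableC.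
  by apply: sub_sigma_algebra; exact: closed_openC.
have : \int[mu]_x f x + e <= h + h * \sum_(j < m) lam (C j).
  apply: (@closed_cvg _ _ U _ (fun k => h + h * \sum_(j < m) a (C j) k)
     [set y | \int[mu]_x f x + e <= y]); first exact: closed_ge.
    apply: filterE => k /=; apply: le_trans (ltW (Hnt k).2) _.
    rewrite -orbit_avg_sum -orbit_avgZ -[X in X + _](orbit_avg_cst tau h (nt k).2 (n0 k)).
    rewrite -orbit_avgD; apply: le_orbit_avg => x; rewrite -layersE.
    exact: layers_ge.
  apply: cvgD; first exact: cvg_cst.
  apply: cvgMl_tmp; apply: cvg_big => [|j _]; [exact: add_continuous|exact: cva].
(* On each closed [C j], [lam] is at most [nu], which equals [mu] by unique ergodicity; then the
   layers lie below [f]. *)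
have : h * \sum_(j < m) lam (C j) <= \int[mu]_x f x.
  apply: (@le_trans _ _ (h * \sum_(j < m) fine (mu (C j)))).
    rewrite ler_pM2l//; apply: ler_sum => j _.
    have mC : measurable (C j : set (borel_of M)).
      by rewrite -[C j]setCK; apply: measurableC; apply: sub_sigma_algebra; exact: closed_openC.
    rewrite -lee_fin fineK ?fin_num_measure// -(uniq nu)//; exact: lamnu.
  under eq_bigr => j _.
    rewrite -mean_indic; last first.
      by rewrite -[C j]setCK; apply: measurableC; apply: sub_sigma_algebra; exact: closed_openC.
    over.
  rewrite -mean_sum// -meanZ; last exact: bmfun_sum.
  apply: le_mean.
  - by apply: bmfunZ; exact: bmfun_sum.
  - exact: continuous_bmfun.
  - by move=> x; rewrite -layersE; exact: layers_le.
(* Together the two bounds give [e <= h], although [h] is [e / 2]. *)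
rewrite /h; lra.
Unshelve. all: by end_near. Qed.

Let uniform_upper (f : M -> R) (e : R) : continuous f -> 0 < e ->
  exists N, forall n t, (N <= n)%N ->
    orbit_avg tau f n t <= \int[mu]_x f x + e.
Proof.
move=> cf e0; have [K K0 fK] := continuous_bounded cf.
have bf := continuous_bmfun cf.
have [||N HN] := @uniform_upper_ge0 (fun x => f x + K) e _ _ e0.
- by move=> x; apply: cvgD; [exact: cf|exact: cvg_cst].
- by move=> x; have := fK x; rewrite ler_norml; lra.
(* The successor forces [0 < n], so that the average of the added constant [K] is [K]. *)
exists N.+1 => n t Nn; have := HN n t (ltnW Nn).
rewrite orbit_avgD orbit_avg_cst; last exact: leq_ltn_trans Nn.
rewrite meanD//; last exact: bmfun_cst.
rewrite mean_cst; lra.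
Qed.

Lemma uniquely_ergodic_uniform (f : M -> R) (e : R) : continuous f -> 0 < e ->
  exists N, forall n t, (N <= n)%N ->
    `|orbit_avg tau f n t - \int[mu]_x f x| <= e.
Proof.
move=> cf e0; have [N1 H1] := uniform_upper cf e0.
have cNf : continuous (fun x => -1 * f x).
  by move=> x; apply: cvgMl_tmp; exact: cf.
have [N2 H2] := uniform_upper cNf e0.
exists (maxn N1 N2) => n t; rewrite geq_max => /andP[/(H1 _ t) + /(H2 _ t)].
rewrite orbit_avgZ meanZ; last exact: continuous_bmfun.
rewrite ler_norml; lra.
Qed.

End uniform_ergodic.

(** * Mean ergodic theorem along sparse sequences *)

Lemma norm_avg_le {R : realType} (n : nat) (x : nat -> R) (K : R) : 0 <= K ->
  (forall i, `|x i| <= K) -> `|n%:R^-1 * \sum_(i < n) x i| <= K.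
Proof.
move=> K0 xK; case: n => [|n]; first by rewrite invr0 mul0r normr0.
rewrite normrM ger0_norm ?invr_ge0// mulrC ler_pdivrMr ?ltr0n//.
apply: le_trans (ler_norm_sum _ _ _) _.
apply: (@le_trans _ _ (\sum_(i < n.+1) K)); first by apply: ler_sum.
by rewrite sumr_const card_ord mulr_natr.
Qed.

(** Either [y] is at most [e] in absolute value, or one factor of its square exceeds [e].
    Integrated, this bounds a first moment by a second moment. *)
Lemma norm_le_addsqr {R : realType} (y e : R) : 0 < e -> `|y| <= e + e^-1 * y ^+ 2.
Proof.
move=> e0; have [ye|ye] := leP `|y| e.
  by apply: le_trans ye _; rewrite lerDl mulr_ge0 ?invr_ge0 ?sqr_ge0// ltW.
apply: (@le_trans _ _ (e^-1 * y ^+ 2)); last by rewrite lerDr ltW.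
rewrite mulrC ler_pdivlMr// -real_normK ?num_real// expr2.
by rewrite ler_wpM2l// ltW.
Qed.

Section mean_average.
Context {R : realType} {d : measure_display} {T : measurableType d}.
Context (P : probability T R).

Lemma bmfun_avg n (Z : nat -> T -> R) : (forall i, bmfun (Z i)) ->
  bmfun (fun w => n%:R^-1 * \sum_(i < n) Z i w).
Proof. by move=> bZ; apply: bmfunZ; apply: bmfun_sum. Qed.

Lemma mean_norm_avg_le n (Z : nat -> T -> R) (e : R) : 0 <= e ->
  (forall i, bmfun (Z i)) -> (forall i, \int[P]_w `|Z i w| <= e) ->
  \int[P]_w `|n%:R^-1 * \sum_(i < n) Z i w| <= e.
Proof.
move=> e0 bZ Ze.
have bnZ i : bmfun (fun w => `|Z i w|) by exact: bmfun_norm.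
apply: (@le_trans _ _ (\int[P]_w (n%:R^-1 * \sum_(i < n) `|Z i w|))).
  apply: le_mean.
  - by apply: bmfun_norm; exact: bmfun_avg.
  - exact: (bmfun_avg n bnZ).
  - move=> w; rewrite normrM ger0_norm ?invr_ge0// ler_wpM2l ?invr_ge0//.
    exact: ler_norm_sum.
rewrite meanZ; last exact: bmfun_sum.
rewrite mean_sum//.
apply: le_trans (ler_norm _) _.
apply: (@norm_avg_le _ n (fun i => \int[P]_w `|Z i w|)) => // i.
by rewrite ger0_norm// mean_norm_ge0.
Qed.

End mean_average.

Section mixing_average.
Context {R : realType} {dO : measure_display} {Omega : measurableType dO}.
Context (P : probability Omega R) (d : nat).
Context (theta : 'rV[int]_d -> Omega -> Omega).
Context (pres : preserving_group P theta) (mixing : strongly_mixing P theta).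
Context (I : Type) (k : I -> nat -> 'rV[int]_d).
Context (sparse : forall (m : nat) (e : R), 0 < e ->
  exists N, forall n t, (N <= n)%N ->
    \sum_(i < n) \sum_(j < n) (zmaxnorm (k t i - k t j) <= m)%N%:R
      <= e * n%:R ^+ 2).

Let mtheta l : measurable_fun setT (theta l).
Proof. by have [] := pres. Qed.

Let mean_theta l (f : Omega -> R) : bmfun f ->
  \int[P]_w f (theta l w) = \int[P]_w f w.
Proof. by have [? pt _ _ _] := pres; move=> bf; apply: mean_comp => //; exact: pt. Qed.

Definition deviation (h : Omega -> R) n t (c : nat -> R) w : R :=
  n%:R^-1 * \sum_(i < n) c i * (h (theta (k t i) w) - \int[P]_x h x).

(** The threshold is uniform in the weights [c] as well as in [t]: later the weights are indicators
    that depend on the orbit of [t]. *)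
Definition mean_ergodic (h : Omega -> R) := forall e : R, 0 < e ->
  exists N, forall n t c, (N <= n)%N -> (forall i, `|c i| <= 1) ->
    \int[P]_w `|deviation h n t c w| <= e.

Lemma bmfun_deviation h n t c : bmfun h -> bmfun (deviation h n t c).
Proof.
move=> bh.
apply: (bmfun_avg n (Z := fun i w => c i * (h (theta (k t i) w) - \int[P]_x h x))) => i.
by apply: bmfunZ; apply: bmfunB; [exact: bmfun_comp|exact: bmfun_cst].
Qed.

Lemma mean_ergodic_cst a : mean_ergodic (fun=> a).
Proof.
move=> e e0; exists 0%N => n t c _ _.
rewrite /deviation !mean_cst; apply: le_trans (ltW e0).
by rewrite big1 ?mulr0 ?normr0// => i _; rewrite subrr mulr0.
Qed.

Lemma mean_ergodicD f g : bmfun f -> bmfun g -> mean_ergodic f ->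
  mean_ergodic g -> mean_ergodic (fun w => f w + g w).
Proof.
move=> bf bg hf hg e e0; have e20 : 0 < e / 2 by rewrite divr_gt0.
have [N1 H1] := hf _ e20; have [N2 H2] := hg _ e20.
exists (maxn N1 N2) => n t c; rewrite geq_max => /andP[n1 n2] c1.
have bdf := bmfun_deviation n t c bf; have bdg := bmfun_deviation n t c bg.
rewrite (splitr e); apply: le_trans (lerD (H1 _ t _ n1 c1) (H2 _ t _ n2 c1)).
rewrite -meanD; [|exact: bmfun_norm|exact: bmfun_norm].
apply: le_mean.
- by apply: bmfun_norm; apply: bmfun_deviation; exact: bmfunD.
- by apply: bmfunD; exact: bmfun_norm.
move=> w; apply: le_trans (ler_normD _ _).
rewrite /deviation -mulrDr -big_split/= meanD//.
rewrite (eq_bigr (fun i : 'I_n => c i * (f (theta (k t i) w) - \int[P]_x f x) +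
  c i * (g (theta (k t i) w) - \int[P]_x g x)))// => i _; ring.
Qed.

Lemma mean_ergodicZ a f : bmfun f -> mean_ergodic f ->
  mean_ergodic (fun w => a * f w).
Proof.
move=> bf hf e e0; have a0 : 0 < `|a| + 1 by rewrite ltr_wpDl.
have e20 : 0 < e / (`|a| + 1) by rewrite divr_gt0.
have [N H] := hf _ e20; exists N => n t c nN c1.
have := H n t c nN c1; rewrite ler_pdivlMr// mulrC => H'.
have bdf := bmfun_deviation n t c bf.
apply: le_trans H'; rewrite -meanZ; last exact: bmfun_norm.
apply: le_mean.
- by apply: bmfun_norm; apply: bmfun_deviation; exact: bmfunZ.
- by apply: bmfunZ; exact: bmfun_norm.
move=> w; rewrite (_ : deviation _ _ _ _ _ = a * deviation f n t c w).
  by rewrite normrM ler_wpM2r// lerDl.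
rewrite /deviation mulrCA; congr (_ * _); rewrite mulr_sumr meanZ//.
by apply: eq_bigr => i _; ring.
Qed.

Lemma mean_ergodic_sum (J : Type) (s : seq J) (f : J -> Omega -> R) :
  (forall j, bmfun (f j)) -> (forall j, mean_ergodic (f j)) ->
  mean_ergodic (fun w => \sum_(j <- s) f j w).
Proof.
move=> bf hf; elim: s => [|j s ih].
  by under eq_fun do rewrite big_nil; exact: mean_ergodic_cst.
under eq_fun do rewrite big_cons.
by apply: mean_ergodicD => //; exact: bmfun_sum.
Qed.

(** Replacing [f] by [g] moves each centered term by at most twice the uniform distance, once for
    the value and once for the mean. *)
Lemma mean_ergodic_unif f : bmfun f ->
  (forall e, 0 < e -> exists g, [/\ bmfun g, mean_ergodic g &
     forall w, `|f w - g w| <= e]) -> mean_ergodic f.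
Proof.
move=> bf hf e e0; have e30 : 0 < e / 3 by rewrite divr_gt0.
have [g [bg hg fg]] := hf _ e30; have [N H] := hg _ e30.
exists N => n t c nN c1; have := H n t c nN c1.
have bdg := bmfun_deviation n t c bg; have bdf := bmfun_deviation n t c bf.
suff : \int[P]_w `|deviation f n t c w| <=
  \int[P]_w (`|deviation g n t c w| + 2 * (e / 3)).
  rewrite meanD; [|exact: bmfun_norm|exact: bmfun_cst].
  rewrite mean_cst; lra.
apply: le_mean.
- exact: bmfun_norm.
- by apply: bmfunD; [exact: bmfun_norm|exact: bmfun_cst].
move=> w; rewrite -lerBlDl; apply: le_trans (lerB_dist _ _) _.
rewrite /deviation -mulrBr -sumrB.
apply: (@norm_avg_le _ n (fun i => c i * (f (theta (k t i) w) - \int[P]_x f x) -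
  c i * (g (theta (k t i) w) - \int[P]_x g x))) => [|i]; first by lra.
rewrite -mulrBr normrM -[leRHS]mul1r ler_pM//.
have : `|\int[P]_x f x - \int[P]_x g x| <= e / 3.
  rewrite -meanB//; apply: le_trans (le_norm_mean _ _) _; first exact: bmfunB.
  by apply: mean_le_cst => //; apply: bmfun_norm; exact: bmfunB.
by have := fg (theta (k t i) w); rewrite !ler_norml; lra.
Qed.

(** Invariance under [theta l'] reduces the covariance to one that depends on [l - l'] only. Mixing
    handles distant indices; for close ones the integrand is bounded by 1, which the indicator term
    pays for. *)
Let mixing_cov (B : set Omega) (e : R) : measurable B -> 0 < e ->
  exists m : nat, forall l l',
    `|\int[P]_w ((\1_B (theta l w) - fine (P B)) * (\1_B (theta l' w) - fine (P B)))|
      <= e + (zmaxnorm (l - l') <= m)%N%:R.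
Proof.
move=> mB e0; have [N HN] := mixing mB mB e0; exists N => l l'.
have bB : bmfun (\1_B : Omega -> R) by exact: bmfun_indic.
have PB01 : 0 <= fine (P B) <= 1.
  rewrite fine_ge0//= -lee_fin fineK ?fin_num_measure//; exact: probability_le1.
have b1 : bmfun (fun w => \1_B (theta l w) - fine (P B)).
  by apply: bmfunB; [exact: bmfun_comp|exact: bmfun_cst].
have b2 : bmfun (fun w => \1_B (theta l' w) - fine (P B)).
  by apply: bmfunB; [exact: bmfun_comp|exact: bmfun_cst].
have g1 x : `|\1_B x - fine (P B)| <= 1.
  rewrite indicE ler_norml; case: (x \in B) => /=; lra.
have [_|far] := leqP (zmaxnorm (l - l')) N.
  apply: le_trans (le_norm_mean _ (bmfunM b1 b2)) _.
  apply: mean_le_cst; first by apply: bmfun_norm; exact: bmfunM.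
  move=> w; apply: (@le_trans _ _ 1); last by rewrite lerDr ltW.
  by rewrite normrM -[leRHS]mulr1 ler_pM.
rewrite addr0; apply: ltW; have := HN _ far; congr (`|_| < _).
have [_ pt th0 thD _] := pres.
(* Composed with [theta l'], this is the expanded product of the two centered indicators. *)
set g := fun w => \1_B w * \1_B (theta (l - l') w) - fine (P B) * \1_B w
   - fine (P B) * \1_B (theta (l - l') w) + fine (P B) ^+ 2.
have bBl : bmfun (fun w => \1_B (theta (l - l') w) : R) by exact: bmfun_comp.
have bg1 : bmfun (fun w => \1_B w * \1_B (theta (l - l') w) - fine (P B) * \1_B w).
  by apply: bmfunB; [exact: bmfunM|exact: bmfunZ].
have bg2 : bmfun (fun w => \1_B w * \1_B (theta (l - l') w) - fine (P B) * \1_B w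
   - fine (P B) * \1_B (theta (l - l') w)).
  by apply: bmfunB => //; exact: bmfunZ.
have bg : bmfun g by apply: bmfunD => //; exact: bmfun_cst.
transitivity (\int[P]_w g w); last first.
  rewrite -(mean_theta l' bg); apply: eq_Rintegral => w _; rewrite /g.
  have -> : theta (l - l') (theta l' w) = theta l w.
    by rewrite -[LHS]/((theta (l - l') \o theta l') w) -thD subrK.
  ring.
rewrite /g meanD//; last exact: bmfun_cst.
rewrite meanB//; last exact: bmfunZ.
rewrite meanB; [|exact: bmfunM|exact: bmfunZ].
rewrite mean_cst !meanZ// mean_theta// mean_indic//.
have -> : \int[P]_w (\1_B w * \1_B (theta (l - l') w)) =
    fine (P (B `&` theta (l - l') @^-1` B)).
  rewrite -mean_indic; last first.
    by apply: measurableI => //; rewrite -[X in measurable X]setTI; exact: mtheta.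
  by apply: eq_Rintegral => w _; rewrite indicI.
ring.
Qed.

Lemma mean_ergodic_indic (B : set Omega) : measurable B ->
  mean_ergodic (\1_B : Omega -> R).
Proof.
move=> mB e e0.
have e20 : 0 < e / 2 by rewrite divr_gt0.
(* Used twice, for the covariances of distant pairs and for the proportion of close pairs, so that
   the second moment is at most [(e / 2) ^+ 2]. *)
have e30 : 0 < (e / 2) ^+ 2 / 2 by rewrite divr_gt0// exprn_gt0.
have [m Hm] := mixing_cov mB e30; have [N HN] := sparse m e30.
exists N.+1 => n t c nN c1.
have n0 : 0 < n%:R ^+ 2 :> R by rewrite exprn_gt0// ltr0n; exact: leq_trans nN.
have bB : bmfun (\1_B : Omega -> R) by exact: bmfun_indic.
have bd := bmfun_deviation n t c bB.
have bd2 : bmfun (fun w => deviation \1_B n t c w ^+ 2) by exact: (bmfunM bd bd).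
suff H2 : \int[P]_w (deviation \1_B n t c w ^+ 2) <= (e / 2) ^+ 2.
  apply: (@le_trans _ _ (\int[P]_w (e / 2 + (e / 2)^-1 * deviation \1_B n t c w ^+ 2))).
    apply: le_mean.
    - exact: bmfun_norm.
    - by apply: bmfunD; [exact: bmfun_cst|exact: bmfunZ].
    - by move=> w; exact: norm_le_addsqr.
  rewrite meanD; [|exact: bmfun_cst|exact: bmfunZ].
  rewrite mean_cst meanZ// [leRHS]splitr lerD2l mulrC ler_pdivrMr//.
pose g i w := c i * (\1_B (theta (k t i) w) - fine (P B)).
have bg i : bmfun (g i).
  by apply: bmfunZ; apply: bmfunB; [exact: bmfun_comp|exact: bmfun_cst].
have -> : \int[P]_w (deviation \1_B n t c w ^+ 2) =
    (n%:R ^+ 2)^-1 * \sum_(i < n) \sum_(j < n) \int[P]_w (g i w * g j w).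
  have bij i j : bmfun (fun w => g i w * g j w) by exact: bmfunM.
  under [in RHS]eq_bigr => i _ do rewrite -mean_sum//.
  rewrite -mean_sum; last by move=> i; exact: bmfun_sum.
  rewrite -meanZ; last by apply: bmfun_sum => i; exact: bmfun_sum.
  apply: eq_Rintegral => w _; rewrite /deviation mean_indic// exprMn exprVn.
  by rewrite [X in _ * X]expr2 big_distrlr.
rewrite mulrC ler_pdivrMr//.
apply: (@le_trans _ _ (\sum_(i < n) \sum_(j < n)
   ((e / 2) ^+ 2 / 2 + (zmaxnorm (k t i - k t j) <= m)%N%:R))).
  apply: ler_sum => i _; apply: ler_sum => j _.
  apply: le_trans (ler_norm _) _; apply: le_trans (Hm _ _).
  rewrite [X in `|X|](_ : _ = (c i * c j) * \int[P]_w ((\1_B (theta (k t i) w) - fine (P B)) *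
    (\1_B (theta (k t j) w) - fine (P B)))).
    by rewrite !normrM -[leRHS]mul1r ler_pM// -[leRHS]mul1r ler_pM.
  rewrite -meanZ; first by apply: eq_Rintegral => w _; rewrite /g; ring.
  by apply: bmfunM; apply: bmfunB; [exact: bmfun_comp|exact: bmfun_cst|exact: bmfun_comp|exact: bmfun_cst].
under eq_bigr => i _ do rewrite big_split/= sumr_const card_ord.
rewrite big_split/= sumr_const card_ord.
have := HN n t (ltnW nN); rewrite -mulrnA -[X in X + _]mulr_natr natrM; lra.
Qed.

(** Adding the bound [K] makes [h] nonnegative; layers of height [e] then approximate it uniformly
    by combinations of indicators. *)
Theorem mean_ergodic_bmfun (h : Omega -> R) : bmfun h -> mean_ergodic h.
Proof.
move=> bh; apply: mean_ergodic_unif => // e e0; have [mh [K hK]] := bh.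
pose m := (Num.truncn ((K + K) / e)).+1.
pose C j := [set w | j.+1%:R * e <= h w + K].
have mC j : measurable (C j).
  rewrite -[C j]setTI; apply: measurable_fun_le => //.
  by apply: measurable_funD.
exists (fun w => e * \sum_(j < m) \1_(C j) w - K).
have bC j : bmfun (\1_(C j) : Omega -> R) by exact: bmfun_indic.
have bs : bmfun (fun w => e * \sum_(j < m) \1_(C j) w) by apply: bmfunZ; exact: bmfun_sum.
split.
- by apply: bmfunB => //; exact: bmfun_cst.
- apply: mean_ergodicD => //; [exact: bmfun_cst| |exact: mean_ergodic_cst].
  apply: mean_ergodicZ; first exact: bmfun_sum.
  by apply: mean_ergodic_sum => // j; exact: mean_ergodic_indic.
move=> w; have := hK w; rewrite ler_norml => /andP[hK1 hK2].
have h0 : 0 <= h w + K by lra.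
have hm : h w + K <= m.+1%:R * e.
  apply: (@le_trans _ _ (K + K)); first by lra.
  rewrite -ler_pdivrMr//; apply: ltW; apply: lt_trans (truncnS_gt _) _.
  by rewrite ltr_nat.
have -> : \sum_(j < m) \1_(C j) w = layers e m (h w + K).
  by apply: eq_bigr => j _; rewrite indicE; congr (nat_of_bool _)%:R; apply/idP/idP => [/set_mem|?]; last exact: mem_set.
have := layers_le e0 m h0; have := layers_ge e0 hm.
rewrite ler_norml; lra.
Qed.

End mixing_average.

(** * Bounded integrands *)

Section sparse_cocycle.
Context {R : realType} {M : Type} (d : nat) (tau : M -> M) (kappa : M -> 'rV[int]_d).

Let close i j m t : nat :=
  (zmaxnorm (cocycle tau kappa i t - cocycle tau kappa j t) <= m)%N.

Lemma close_pairsE m n t :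
  close_pairs tau kappa m n t = (\sum_(i < n) \sum_(j < n) close i.+1 j.+1 m t)%N.
Proof.
rewrite pair_bigA/= /close_pairs -sum1_card big_mkcond/=.
by apply: eq_bigr => -[i j] _; rewrite unfold_in /in_set asboolb /close; case: leq.
Qed.

(* [close_pairs] ranges over [1 <= i, j <= n], the ergodic averages over
   [0 <= i < n]: the pairs with a zero index account for [2 n + 1]. *)
Lemma sum_close_le m n t : (\sum_(i < n) \sum_(j < n) close i j m t <=
  close_pairs tau kappa m n t + n.*2.+1)%N.
Proof.
have le1 i j : (close i j m t <= 1)%N by exact: leq_b1.
apply: (@leq_trans (\sum_(i < n.+1) \sum_(j < n.+1) close i j m t)%N).
  rewrite big_ord_recr/=; apply: leq_trans (leq_addr _ _).
  by apply: leq_sum => i _; rewrite big_ord_recr/= leq_addr.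
rewrite big_ord_recl/= addnC close_pairsE.
have -> : n.*2.+1 = (n + n.+1)%N by rewrite addnS addnn.
rewrite addnA leq_add//; last first.
  by rewrite -[leqRHS]card_ord -sum1_card; apply: leq_sum.
under eq_bigr => i _ do rewrite big_ord_recl/= addnC.
rewrite big_split/= leq_add//.
by rewrite -[leqRHS]card_ord -sum1_card; apply: leq_sum.
Qed.

Lemma sparse_cocycle :
  (forall m : nat, (fun n : nat => (n%:R ^+ 2)^-1 *
        sup (range (fun t : M => (close_pairs tau kappa m n t)%:R)))
       @ \oo --> (0 : R)) ->
  forall (m : nat) (e : R), 0 < e ->
  exists N, forall n t, (N <= n)%N ->
    \sum_(i < n) \sum_(j < n)
      (zmaxnorm (cocycle tau kappa i t - cocycle tau kappa j t) <= m)%N%:R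
      <= e * n%:R ^+ 2.
Proof.
move=> H m e e0.
have e20 : 0 < e / 2 by rewrite divr_gt0.
have /cvgrPdist_le/(_ _ e20)[N _ HN] := H m.
(* Beyond [6 / e], the boundary term [2 n + 1 <= 3 n] is at most [e / 2] times the square of [n];
   the other half of [e] is for the close pairs. *)
exists (maxn N (Num.truncn (6 / e)).+1).+1 => n t; rewrite gtn_max => /andP[Nn en].
have {en} en : 3 <= e / 2 * n%:R.
  have : 6 / e < n%:R.
    by apply: lt_trans (truncnS_gt _) _; rewrite ltr_nat.
  by rewrite ltr_pdivrMr//; lra.
have n1 : 1 <= n%:R :> R by rewrite ler1n; exact: leq_ltn_trans Nn.
have n2 : 0 < n%:R ^+ 2 :> R by rewrite exprn_gt0//; lra.
have {HN} := HN n (ltnW Nn); rewrite /= sub0r normrN => /(le_trans (ler_norm _)).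
rewrite mulrC ler_pdivrMr// => Hs.
have Ht : (close_pairs tau kappa m n t)%:R <=
    sup (range (fun t : M => (close_pairs tau kappa m n t)%:R)) :> R.
  apply: ub_le_sup; last by exists t.
  (* A real [sup] dominates its set only when the set is bounded: there are at most [n * n]
     pairs. *)
  exists (n * n)%:R => _ [s _ <-]; rewrite ler_nat.
  by rewrite /close_pairs; apply: leq_trans (max_card _) _; rewrite card_prod !card_ord.
have : (\sum_(i < n) \sum_(j < n) close i j m t)%:R <= (close_pairs tau kappa m n t)%:R
    + 2 * n%:R + 1 :> R.
  by rewrite -natrM -natrD natr1 ler_nat mul2n -addnS sum_close_le.
rewrite natr_sum; under eq_bigr => i _ do rewrite natr_sum.
nra.
Qed.

End sparse_cocycle.

(** * Mean convergence for bounded integrands, uniformly in the starting point *)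

Section bounded_case.
Context {R : realType} {M : pseudoPMetricType R} {dO : measure_display}
  {Omega : measurableType dO}.
Context (P : probability Omega R) (d : nat) (tau : M -> M)
  (mu : probability (borel_of M) R)
  (theta : 'rV[int]_d -> Omega -> Omega) (kappa : M -> 'rV[int]_d).
Context (hM : hausdorff_space M) (cM : compact [set: M]).
Context (ue : uniquely_ergodic_with tau mu) (pres : preserving_group P theta)
  (mixing : strongly_mixing P theta).
Context (sparse : forall (m : nat) (e : R), 0 < e ->
  exists N, forall n t, (N <= n)%N ->
    \sum_(i < n) \sum_(j < n)
      (zmaxnorm (cocycle tau kappa i t - cocycle tau kappa j t) <= m)%N%:R
      <= e * n%:R ^+ 2).
Context (F : M * Omega -> R) (K : R).
Context (mF : measurable_fun [set: (borel_of M * Omega)%type] F).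
Context (FK : forall z, `|F z| <= K).
Context (cF : {ae P, forall w, continuous (fun t : M => F (t, w))}).

Let X (s : M) (w : Omega) : R := F (s, w).

Let bX s : bmfun (X s).
Proof.
split; last by exists K => w; exact: FK.
exact: (measurableT_comp mF (@pair1_measurable _ _ (borel_of M) Omega s)).
Qed.

Let nX s s' : bmfun (fun w => `|X s w - X s' w|).
Proof. by apply: bmfun_norm; exact: bmfunB. Qed.

(** If it failed, a sequence [u] converging to [s] would stay at distance more than [e] in mean,
    against dominated convergence with the constant bound [K + K]. *)
Let X_near s (e : R) : 0 < e ->
  \forall s' \near s, \int[P]_w `|X s w - X s' w| <= e.
Proof.
move=> e0; apply: contrapT => nA.
have [u Hu] : {u : nat -> M & forall n, ball s n.+1%:R^-1 (u n) /\
    e < \int[P]_w `|X s w - X (u n) w|}.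
  apply: (@choice _ _ (fun n x => ball s n.+1%:R^-1 x /\
     e < \int[P]_w `|X s w - X x w|)) => n.
  apply: contrapT => /forallNP H; apply: nA.
  apply/nbhs_ballP; exists n.+1%:R^-1; first by rewrite /= invr_gt0.
  by move=> x sx /=; rewrite leNgt; apply/negP => ex; exact: (H x).
have us : u @ \oo --> s.
  apply/cvg_ballP => r r0; have := near_infty_natSinv_lt (PosNum r0).
  apply: filterS => n /ltW nr; exact: le_ball nr _ (Hu n).1.
have [] := @dominated_convergence _ _ _ P setT measurableT
  (fun n w => `|X s w - X (u n) w|%:E) (fun=> 0%E) (fun=> (K + K)%:E).
- by move=> n; apply/measurable_EFinP; have [] := nX s (u n).
- exact: measurable_cst.
- apply: filterS cF => w cw _; apply/cvg_EFin; first exact: nearW.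
  rewrite (_ : _ \o _ = fun n => `|X s w - X (u n) w|); last by apply/funext.
  have : (X s w - X (u n) w) @[n --> \oo] --> X s w - X s w.
    by apply: cvgB; [exact: cvg_cst|exact: (cvg_comp _ _ us (cw s))].
  by move=> /cvg_norm; rewrite subrr normr0.
- by have := bmfun_integrable P (bmfun_cst (K + K)).
- apply: aeW => w n _; rewrite abse_EFin lee_fin normr_id.
  by apply: le_trans (ler_normB _ _) _; rewrite lerD// FK.
move=> _ _; rewrite integral0 => /fine_cvg /cvgrPdist_lt/(_ _ e0)[N _ /(_ N (leqnn N))].
rewrite /= sub0r normrN => /(le_lt_trans (ler_norm _)).
by rewrite ltNge => /negP; apply; rewrite ltW//; have [] := Hu N.
Qed.

Let m (s : M) : R := \int[P]_w X s w.

Let m_dist s s' : `|m s - m s'| <= \int[P]_w `|X s w - X s' w|.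
Proof. by rewrite /m -meanB//; apply: le_norm_mean; exact: bmfunB. Qed.

Let continuous_m : continuous m.
Proof.
move=> s; apply/cvgrPdist_le => e e0; have := X_near s e0.
by apply: filterS => s'; exact: le_trans.
Qed.

Lemma bounded_fubini : fine (\int[mu \x P]_z (F z)%:E)%E = \int[mu]_s m s.
Proof.
have iF : (mu \x P)%E.-integrable setT (EFin \o F).
  by apply: bmfun_integrable; split => //; exists K.
rewrite /Rintegral -(integral12_prod_meas1 iF); congr fine.
apply: eq_integral => s _; rewrite /fubini_F /m /Rintegral fineK//.
by apply: integrable_fin_num => //; exact: bmfun_integrable.
Qed.

(** Compactness of [M] and continuity into the space of integrable functions. [uniq s] ensures that
    a sum over the net meets [J x] exactly once. *)
Let finite_net (e : R) : 0 < e -> exists (s : seq M) (J : M -> M), uniq s /\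
  forall x, J x \in s /\ \int[P]_w `|X x w - X (J x) w| <= e.
Proof.
move=> e0; move: cM; rewrite compact_cover.
move=> /(_ M setT (fun z => [set x | \int[P]_w `|X z w - X x w| <= e]°)).
case=> [z _|x _|D _ HD]; first exact: open_interior.
  by exists x => //; exact: X_near.
have [J HJ] : {J : M -> M & forall x, J x \in D /\ \int[P]_w `|X x w - X (J x) w| <= e}.
  apply: (@choice _ _ (fun x z => z \in D /\ \int[P]_w `|X x w - X z w| <= e)) => x.
  have [z Dz /interior_subset/= zx] := HD x I.
  by exists z; split => //; under eq_Rintegral do rewrite distrC.
by exists D, J; split; first exact: fset_uniq.
Qed.

Let mtheta l : measurable_fun setT (theta l).
Proof. by have [] := pres. Qed.

Let bXt s l : bmfun (fun w => X s (theta l w)).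
Proof. exact: bmfun_comp. Qed.

Let centered_average (e : R) : 0 < e -> exists N, forall n t, (N <= n)%N ->
  \int[P]_w `|n%:R^-1 * \sum_(i < n) (X (iter i tau t) (theta (cocycle tau kappa i t) w)
    - m (iter i tau t))| <= e.
Proof.
move=> e0; have e30 : 0 < e / 3 by rewrite divr_gt0.
have [s [J [us HJ]]] := finite_net e30.
(* The successor keeps the denominator positive whatever the size of the net. *)
have e40 : 0 < e / 3 / (size s).+1%:R by rewrite divr_gt0.
have [Nz HNz] : {Nz : M -> nat & forall z n t c, (Nz z <= n)%N -> (forall i, `|c i| <= 1) ->
    \int[P]_w `|deviation P theta (fun t i => cocycle tau kappa i t) (X z) n t c w|
      <= e / 3 / (size s).+1%:R}.
  apply: (@choice _ _ (fun z N => forall n t c, (N <= n)%N -> (forall i, `|c i| <= 1) ->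
    \int[P]_w `|deviation P theta (fun t i => cocycle tau kappa i t) (X z) n t c w|
      <= e / 3 / (size s).+1%:R)) => z.
  exact: (mean_ergodic_bmfun pres mixing sparse (bX z)).
exists (\max_(z <- s) Nz z) => n t nN.
pose k i := cocycle tau kappa i t; pose x i := iter i tau t.
(* These weights sort the times [i] by the net point that stands for the orbit point, so each [z]
   contributes a weighted average of the single function [X z]. *)
pose c z i : R := (J (x i) == z)%:R.
pose dev z w := deviation P theta (fun t i => cocycle tau kappa i t) (X z) n t (c z) w.
have bdev z : bmfun (dev z) by exact: bmfun_deviation.
pose Z i w := X (x i) (theta (k i) w) - X (J (x i)) (theta (k i) w)
  - (m (x i) - m (J (x i))).
have bZ1 i : bmfun (fun w => X (x i) (theta (k i) w) - X (J (x i)) (theta (k i) w)).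
  exact: bmfunB.
have bZ i : bmfun (Z i) by apply: bmfunB => //; exact: bmfun_cst.
have decomp w : n%:R^-1 * \sum_(i < n) (X (x i) (theta (k i) w) - m (x i)) =
    n%:R^-1 * \sum_(i < n) Z i w + \sum_(z <- s) dev z w.
  rewrite /dev /deviation -mulr_sumr -mulrDr; congr (_ * _).
  rewrite exchange_big/= -big_split/=; apply: eq_bigr => i _.
  rewrite (bigD1_seq (J (x i)))/=; [|by have [] := HJ (x i)|by []].
  rewrite big1 ?addr0 => [|z zJ].
    by rewrite /c eqxx mul1r /Z -/(m _) -/(k i); ring.
  by rewrite /c eq_sym (negbTE zJ) mul0r.
apply: (@le_trans _ _ (\int[P]_w (`|n%:R^-1 * \sum_(i < n) Z i w| + \sum_(z <- s) `|dev z w|))).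
  apply: le_mean.
  - apply: bmfun_norm.
    apply: (bmfun_avg n (Z := fun i w => X (x i) (theta (k i) w) - m (x i))) => i.
    by apply: bmfunB => //; exact: bmfun_cst.
  - apply: bmfunD; first by apply: bmfun_norm; exact: bmfun_avg.
    by apply: bmfun_sum => z; exact: bmfun_norm.
  - move=> w; rewrite decomp; apply: le_trans (ler_normD _ _) _.
    by rewrite lerD2l; exact: ler_norm_sum.
rewrite meanD; [|by apply: bmfun_norm; exact: bmfun_avg|]; last first.
  by apply: bmfun_sum => z; exact: bmfun_norm.
rewrite mean_sum; last by move=> z; exact: bmfun_norm.
(* Two thirds for the approximation by the net, in values and in means, and one third for all the
   deviations together. *)
have -> : e = e / 3 + e / 3 + e / 3 by lra.
apply: lerD.
  apply: mean_norm_avg_le => // [|i]; first by lra.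
  apply: (@le_trans _ _ (\int[P]_w (`|X (x i) (theta (k i) w) - X (J (x i)) (theta (k i) w)|
    + `|m (x i) - m (J (x i))|))).
    apply: le_mean.
    - exact: bmfun_norm.
    - by apply: bmfunD; [exact: bmfun_norm|exact: bmfun_cst].
    - by move=> w; exact: ler_normB.
  rewrite meanD; [|exact: bmfun_norm|exact: bmfun_cst].
  have [_ Hi] := HJ (x i); rewrite mean_cst lerD//; last exact: le_trans (m_dist _ _) Hi.
  have [_ pt _ _ _] := pres.
  by rewrite (mean_comp (P := P) (f := fun w => `|X (x i) w - X (J (x i)) w|))//; exact: pt.
apply: (@le_trans _ _ (\sum_(z <- s) e / 3 / (size s).+1%:R)).
  rewrite big_seq [leRHS]big_seq; apply: ler_sum => z zs.
  apply: HNz; first by apply: leq_trans nN; exact: leq_bigmax_seq.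
  by move=> i; rewrite /c; case: eqP => _; rewrite ?normr1 ?normr0.
rewrite big_const_seq count_predT iter_addr_0 -[_ *+ size s]mulr_natr -mulrA.
rewrite ler_piMr//; first by lra.
by rewrite mulrC ler_pdivrMr// mul1r ler_nat.
Qed.

Theorem bounded_ergodic (e : R) : 0 < e -> exists N, forall n t, (N <= n)%N ->
  \int[P]_w `|ergodic_avg tau theta kappa F n t w - fine (\int[mu \x P]_z (F z)%:E)%E|
    <= e.
Proof.
move=> e0; have e20 : 0 < e / 2 by rewrite divr_gt0.
have [N1 H1] := centered_average e20.
have [N2 H2] := uniquely_ergodic_uniform hM cM ue continuous_m e20.
exists (maxn N1 N2) => n t; rewrite geq_max => /andP[/(H1 _ t) + /(H2 _ t)].
rewrite bounded_fubini; set I := \int[mu]_s m s => h1 h2.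
pose Z i w := X (iter i tau t) (theta (cocycle tau kappa i t) w) - m (iter i tau t).
have bZ i : bmfun (Z i) by apply: bmfunB => //; exact: bmfun_cst.
have bA : bmfun (ergodic_avg tau theta kappa F n t).
  exact: (bmfun_avg n (Z := fun i w => X (iter i tau t) (theta (cocycle tau kappa i t) w))).
rewrite (splitr e); apply: le_trans (lerD h1 h2).
rewrite -[X in _ <= _ + X](mean_cst P) -meanD; [|exact: (bmfun_norm (bmfun_avg n bZ))|exact: bmfun_cst].
apply: le_mean.
- by apply: bmfun_norm; apply: bmfunB => //; exact: bmfun_cst.
- by apply: bmfunD; [exact: (bmfun_norm (bmfun_avg n bZ))|exact: bmfun_cst].
move=> w; apply: le_trans (ler_normD _ _).
by rewrite /ergodic_avg /orbit_avg sumrB mulrBr addrA subrK.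
Qed.

End bounded_case.

(** * Truncation *)

Section powR_inequalities.
Context {R : realType} (p : R) (p1 : 1 <= p).
Implicit Types a b c x y : R.

Let p0 : 0 < p. Proof. exact: lt_le_trans p1. Qed.

Let le_powRp a b : 0 <= a -> a <= b -> a `^ p <= b `^ p.
Proof.
by move=> a0 ab; apply: ge0_ler_powR; rewrite ?nnegrE ?(ltW p0)//; exact: le_trans ab.
Qed.

(** Jensen's inequality for uniform weights: the average of [n.+1] terms is a convex combination of
    the average of the first [n] and the last term, with weight [n / n.+1] on the former. *)
Lemma powR_avg_le n (x : nat -> R) : (forall i, 0 <= x i) ->
  (n%:R^-1 * \sum_(i < n) x i) `^ p <= n%:R^-1 * \sum_(i < n) x i `^ p.
Proof.
move=> x0; elim: n => [|n ih].
  by rewrite invr0 !mul0r powR0// gt_eqF.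
pose t : R := n%:R / n.+1%:R.
have t0 : 0 <= t by rewrite divr_ge0.
have t1 : t <= 1 by rewrite ler_pdivrMr// mul1r ler_nat.
have step (y : nat -> R) : n.+1%:R^-1 * \sum_(i < n.+1) y i =
    t * (n%:R^-1 * \sum_(i < n) y i) + (1 - t) * y n.
  rewrite big_ord_recr/= /t; case: n {ih t t0 t1} => [|n].
    by rewrite big_ord0 !mul0r subr0 invr1 !mul1r.
  rewrite -[n.+2%:R]natr1; have : 0 < n.+1%:R :> R by rewrite ltr0n.
  move: (n.+1%:R) => a a0; have a10 : 0 < a + 1 by lra.
  by field; rewrite !gt_eqF.
rewrite (step x) (step (fun i => x i `^ p)).
have a0 : 0 <= n%:R^-1 * \sum_(i < n) x i by rewrite mulr_ge0// sumr_ge0.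
apply: (@le_trans _ _ (t * (n%:R^-1 * \sum_(i < n) x i) `^ p + (1 - t) * x n `^ p)).
  by apply: (convex_powR p1 (Itv01 t0 t1)); apply/mem_set; rewrite /= in_itv/= andbT.
by rewrite lerD2r ler_wpM2l.
Qed.

(** The sum is at most three times the largest term, whose power is one of the summands on the
    right. *)
Lemma powR_add3_le a b c : 0 <= a -> 0 <= b -> 0 <= c ->
  (a + b + c) `^ p <= 3 `^ p * (a `^ p + b `^ p + c `^ p).
Proof.
move=> a0 b0 c0.
have H x : a <= x -> b <= x -> c <= x -> 0 <= x -> (a + b + c) `^ p <= 3 `^ p * x `^ p.
  move=> ax bx cx x0; rewrite -powRM//; apply: le_powRp; first by lra.
  by lra.
have := powR_ge0 a p; have := powR_ge0 b p; have := powR_ge0 c p => ? ? ?.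
have [ab|ba] := leP a b; have [bc|cb] := leP b c; have [ac|ca] := leP a c.
all: first [ apply: le_trans (H a _ _ _ _) _; solve [lra | rewrite ler_wpM2l ?powR_ge0//; lra]
           | apply: le_trans (H b _ _ _ _) _; solve [lra | rewrite ler_wpM2l ?powR_ge0//; lra]
           | apply: le_trans (H c _ _ _ _) _; solve [lra | rewrite ler_wpM2l ?powR_ge0//; lra] ].
Qed.

(** Since [y / L] is at most 1, its power is at most itself. For bounded functions this turns
    convergence in mean into convergence of [p]-th moments. *)
Lemma powR_le_linear y L : 1 <= L -> 0 <= y <= L -> y `^ p <= L `^ p * y.
Proof.
move=> L1 /andP[y0 yL]; have L0 : 0 < L by lra.
have [->|yn0] := eqVneq y 0; first by rewrite powR0 ?mulr0// gt_eqF.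
have yp : 0 < y by rewrite lt_neqAle eq_sym yn0.
have -> : y = L * (y / L) by rewrite mulrCA divff ?mulr1// gt_eqF.
rewrite powRM; [|exact: ltW|by rewrite divr_ge0// ltW].
rewrite ler_wpM2l ?powR_ge0//; apply: (@le_trans _ _ (y / L)).
  by apply: ge1r_powR => //; rewrite divr_gt0// ler_pdivrMr// mul1r.
by rewrite ler_peMl// divr_ge0// ltW.
Qed.

End powR_inequalities.

(** * Truncation by the supremum over the space variable *)

Section tail.
Context {R : realType} {M : pseudoPMetricType R} {dO : measure_display}
  {Omega : measurableType dO} (P : probability Omega R) (F : M * Omega -> R).
Context (p : R) (p1 : 1 <= p).

Let G (w : Omega) : \bar R := ereal_sup (range (fun t : M => (`|F (t, w)|)%:E)).

Context (mG : measurable_fun [set: Omega] G) (iG : (Lnorm P p%:E G < +oo)%E).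

Let p0 : 0 < p. Proof. exact: lt_le_trans p1. Qed.

Let F_le_G t w : ((`|F (t, w)|)%:E <= G w)%E.
Proof. by apply: ereal_sup_ubound; exists t. Qed.

Let G_ge0 w : (0 <= G w)%E.
Proof. by apply: le_trans (F_le_G point w); rewrite lee_fin. Qed.

(** The cut depends on [w] alone: each section in [t] is kept whole or set to zero, so continuity
    survives and the error is controlled for all [t] at once. *)
Definition truncation (K : nat) (z : M * Omega) : R :=
  F z * \1_[set w | (G w <= K%:R%:E)%E] z.2.

Definition tail (K : nat) (w : Omega) : \bar R :=
  (G w `^ p * (\1_[set w | (K%:R%:E < G w)%E] w)%:E)%E.

Lemma tail_ge0 K w : (0 <= tail K w)%E.
Proof. by rewrite mule_ge0 ?poweR_ge0// lee_fin. Qed.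

Lemma measurable_tail K : measurable_fun setT (tail K).
Proof.
apply: emeasurable_funM.
  exact: (measurableT_comp (measurable_poweR _)).
apply/measurable_EFinP; apply: measurable_indic.
by rewrite -[X in measurable X]setTI; apply: measurable_lte.
Qed.

Lemma norm_truncation_le K z : `|truncation K z| <= K%:R.
Proof.
case: z => t w; rewrite /truncation/= indicE.
case: (boolP (w \in _)) => [/set_mem/= GK|_]; last by rewrite mulr0 normr0.
rewrite mulr1 -lee_fin; exact: le_trans (F_le_G _ _) GK.
Qed.

Let truncation_cases K t w :
  truncation K (t, w) = F (t, w) \/
  [/\ truncation K (t, w) = 0, tail K w = (G w `^ p)%E & (K%:R%:E < G w)%E].
Proof.
rewrite /truncation /tail !indicE/=.
have [GK|KG] := leP (G w) K%:R%:E; [left|right].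
  by rewrite mem_set// mulr1.
by rewrite memNset ?mulr0/= ?mem_set ?mule1//; apply/negP; rewrite -ltNge.
Qed.

Lemma powR_sub_truncation_le K t w :
  ((`|F (t, w) - truncation K (t, w)| `^ p)%:E <= tail K w)%E.
Proof.
have [->|[-> -> _]] := truncation_cases K t w.
  by rewrite subrr normr0 powR0 ?gt_eqF// tail_ge0.
rewrite subr0 -poweR_EFin; apply: gt0_ler_poweR; first exact: ltW.
- by rewrite in_itv/= lee_fin normr_ge0/= leey.
- by rewrite in_itv/= G_ge0 leey.
- exact: F_le_G.
Qed.

(** Where the truncation acts, [G w] exceeds [K] and hence 1, so it is below its own [p]-th power.
    One tail thus controls both the first and the [p]-th moment of the error. *)
Lemma sub_truncation_le K t w : (0 < K)%N ->
  ((`|F (t, w) - truncation K (t, w)|)%:E <= tail K w)%E.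
Proof.
move=> K0; have [->|[-> -> KG]] := truncation_cases K t w.
  by rewrite subrr normr0 tail_ge0.
rewrite subr0; apply: le_trans (F_le_G _ _) _.
move: KG; case: (G w) => [r| |//]; last by rewrite poweRyr ?leey// gt_eqF.
rewrite lte_fin poweR_EFin lee_fin => Kr; apply: le1r_powR => //.
by apply: le_trans (ltW Kr); rewrite ler1n.
Qed.

Let integrable_Gp : P.-integrable setT (fun w => G w `^ p)%E.
Proof.
have mGp : measurable_fun setT (fun w => G w `^ p)%E.
  exact: (measurableT_comp (measurable_poweR _)).
apply/integrableP; split => //.
(* The norm is an integral to the power [p^-1]; as this exponent is nonzero, finiteness passes to
   the integral. *)
move: iG; rewrite unlock => /lty_poweRy; rewrite invr_eq0 gt_eqF// => /(_ isT).
apply: le_lt_trans; apply: ge0_le_integral => //.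
- exact: measurableT_comp.
- by apply: (measurableT_comp (measurable_poweR _)); exact: measurableT_comp.
- by move=> w _; rewrite !gee0_abs// poweR_ge0.
Qed.

Let tail_le_Gp K w : (tail K w <= G w `^ p)%E.
Proof.
rewrite /tail indicE; case: (w \in _); rewrite ?mule1// mule0; exact: poweR_ge0.
Qed.

(** Dominated convergence below the integrable power of [G]: almost every [G w] is finite, and there
    the tail vanishes once [K] exceeds [G w]. *)
Lemma integral_tail_cvg0 : (\int[P]_w tail K w)%E @[K --> \oo] --> 0%E.
Proof.
have [] := @dominated_convergence _ _ _ P setT measurableT tail (fun=> 0%E)
  (fun w => G w `^ p)%E.
- exact: measurable_tail.
- exact: measurable_cst.
- have := integrable_ae measurableT integrable_Gp.
  apply: filterS => w /(_ I) fGp _.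
  have {}fGp : G w \is a fin_num.
    rewrite ge0_fin_numE// ltey; apply/eqP => Gy.
    by move: fGp; rewrite Gy poweRyr// gt_eqF.
  apply: (@cvg_near_cst _ _ _ _ _ _).
  exists (Num.truncn (fine (G w))).+1 => // n /= gn.
  rewrite /tail indicE memNset ?mule0//=; apply/negP; rewrite -leNgt.
  rewrite -(fineK fGp) lee_fin; apply: ltW; apply: lt_le_trans (truncnS_gt _) _.
  by rewrite ler_nat.
- exact: integrable_Gp.
- by apply: aeW => w n _; rewrite gee0_abs ?tail_ge0.
by move=> _ _; rewrite integral0.
Qed.

Lemma integral_tail_fin K : (\int[P]_w tail K w)%E \is a fin_num.
Proof.
rewrite ge0_fin_numE; last by apply: integral_ge0 => w _; exact: tail_ge0.
have /integrableP[_] := integrable_Gp; apply: le_lt_trans.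
apply: ge0_le_integral => //.
- by move=> w _; exact: tail_ge0.
- exact: measurable_tail.
- by apply: measurableT_comp => //; exact: (measurableT_comp (measurable_poweR _)).
- by move=> w _; rewrite gee0_abs ?poweR_ge0.
Qed.

Lemma measurable_truncation K :
  measurable_fun [set: (borel_of M * Omega)%type] F ->
  measurable_fun [set: (borel_of M * Omega)%type] (truncation K).
Proof.
move=> mF; apply: measurable_funM => //.
apply: (@measurableT_comp _ _ _ _ _ _
  (\1_[set w | (G w <= K%:R%:E)%E] : Omega -> R)); last exact: measurable_snd.
apply: measurable_indic; rewrite -[X in measurable X]setTI.
by apply: measurable_lee.
Qed.

Lemma ae_continuous_truncation K :
  {ae P, forall w, continuous (fun t : M => F (t, w))} ->
  {ae P, forall w, continuous (fun t : M => truncation K (t, w))}.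
Proof.
apply: filterS => w cw t; rewrite /truncation/=.
by apply: cvgM; [exact: cw|exact: cvg_cst].
Qed.

Lemma integral_sub_truncation_le (mu : probability (borel_of M) R) K : (0 < K)%N ->
  measurable_fun [set: (borel_of M * Omega)%type] F ->
  `|fine (\int[mu \x P]_z (F z)%:E)%E - fine (\int[mu \x P]_z (truncation K z)%:E)%E|
    <= fine (\int[P]_w tail K w)%E.
Proof.
move=> K0 mF; have mT := measurable_truncation K mF.
have mD : measurable_fun [set: (borel_of M * Omega)%type] (fun z => F z - truncation K z).
  exact: measurable_funB.
have iT : (mu \x P)%E.-integrable setT (EFin \o truncation K).
  by apply: bmfun_integrable; split => //; exists K%:R; exact: norm_truncation_le.
have leD : (\int[mu \x P]_z `|(F z - truncation K z)%:E| <= \int[P]_w tail K w)%E.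
  rewrite fubini_tonelli1//; last first.
    by apply: measurableT_comp => //; apply/measurable_EFinP.
  apply: (@le_trans _ _ (\int[mu]_s cst (\int[P]_w tail K w) s)%E); last first.
    rewrite integral_cst// [X in (_ * X)%E](_ : _ = 1%E) ?mule1//.
    exact: probability_setT.
  apply: ge0_le_integral => //.
  - by move=> s _; exact: integral_ge0.
  - apply: measurable_fun_fubini_tonelli_F => //.
    by apply: measurableT_comp => //; apply/measurable_EFinP.
  move=> s _; rewrite /fubini_F; apply: ge0_le_integral => //.
  - apply: measurableT_comp => //; apply/measurable_EFinP.
    exact: (measurableT_comp mD (@pair1_measurable _ _ (borel_of M) Omega s)).
  - exact: measurable_tail.
  - by move=> w _; rewrite abse_EFin; exact: sub_truncation_le.
have iD : (mu \x P)%E.-integrable setT (EFin \o (fun z => F z - truncation K z)).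
  apply/integrableP; split; first exact/measurable_EFinP.
  apply: le_lt_trans leD _; rewrite -ge0_fin_numE ?integral_tail_fin//.
  by apply: integral_ge0 => w _; exact: tail_ge0.
(* Both pieces are integrable, one by boundedness and the other by Tonelli and the tail bound, so
   the integral of [F] is finite and [fine] loses nothing. *)
have -> : (\int[mu \x P]_z (F z)%:E = \int[mu \x P]_z (truncation K z)%:E +
    \int[mu \x P]_z (F z - truncation K z)%:E)%E.
  rewrite -integralD_EFin//; apply: eq_integral => z _ /=.
  by rewrite -EFinD addrC subrK.
rewrite fineD; [|exact: integrable_fin_num|exact: integrable_fin_num].
rewrite addrAC subrr add0r -lee_fin fineK ?integral_tail_fin//.
apply: le_trans leD; apply: le_trans (le_abse_integral _ _ _) => //.
  by rewrite -[X in (_ <= `|X|)%E]fineK//; exact: integrable_fin_num.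
exact/measurable_EFinP.
Qed.

End tail.

Lemma Lnorm_le_of_integral {R : realType} {d : measure_display}
  {T : measurableType d} (P : probability T R) (p e : R) (Y : T -> R) :
  0 < p -> 0 < e ->
  (\int[P]_w (`|Y w| `^ p)%:E <= (e `^ p)%:E)%E ->
  (Lnorm P p%:E (fun w => (Y w)%:E) <= e%:E)%E.
Proof.
move=> p0 e0 H; rewrite unlock.
under eq_integral do rewrite abse_EFin poweR_EFin.
have -> : e%:E = ((e `^ p)%:E `^ p^-1)%E.
  by rewrite poweR_EFin -powRrM mulfV ?gt_eqF// powRr1// ltW.
apply: gt0_ler_poweR => //; first by rewrite invr_ge0 ltW.
- rewrite in_itv/= leey andbT; apply: integral_ge0 => w _.
  by rewrite lee_fin powR_ge0.
- by rewrite in_itv/= leey andbT lee_fin powR_ge0.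
Qed.

Lemma cvge0_nonneg {R : realType} (u : nat -> \bar R) :
  (forall n, 0 <= u n)%E ->
  (forall e : R, 0 < e -> exists N, forall n, (N <= n)%N -> (u n <= e%:E)%E) ->
  u @ \oo --> 0%E.
Proof.
move=> u0 H; apply/fine_cvgP; split.
  have [N HN] := H 1 ltr01; exists N => // n /= Nn.
  by rewrite ge0_fin_numE//; apply: le_lt_trans (HN n Nn) (ltry _).
apply/cvgrPdist_le => e e0; have [N HN] := H e e0; exists N => // n /= Nn.
have fu : u n \is a fin_num by rewrite ge0_fin_numE//; apply: le_lt_trans (HN n Nn) (ltry _).
by rewrite sub0r normrN ger0_norm ?fine_ge0// -lee_fin fineK// HN.
Qed.

(** * Moments of the error for unbounded integrands *)

Section unbounded_case.
Context {R : realType} {M : pseudoPMetricType R} {dO : measure_display}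
  {Omega : measurableType dO}.
Context (P : probability Omega R) (d : nat) (tau : M -> M)
  (mu : probability (borel_of M) R)
  (theta : 'rV[int]_d -> Omega -> Omega) (kappa : M -> 'rV[int]_d) (p : R).
Context (pres : preserving_group P theta) (p1 : 1 <= p).
Context (F : M * Omega -> R).
Let G (w : Omega) : \bar R := ereal_sup (range (fun t : M => (`|F (t, w)|)%:E)).
Context (mF : measurable_fun [set: (borel_of M * Omega)%type] F).
Context (mG : measurable_fun [set: Omega] G) (iG : (Lnorm P p%:E G < +oo)%E).

Let p0 : 0 < p. Proof. exact: lt_le_trans p1. Qed.

Let mtheta l : measurable_fun setT (theta l).
Proof. by have [] := pres. Qed.

Local Notation EF := (fine (\int[mu \x P]_z (F z)%:E)%E).
Local Notation FK := (truncation F).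
Local Notation EFK K := (fine (\int[mu \x P]_z (FK K z)%:E)%E).
Local Notation A := (ergodic_avg tau theta kappa).

Lemma measurable_ergodic_avg (f : M * Omega -> R) n t :
  measurable_fun [set: (borel_of M * Omega)%type] f ->
  measurable_fun setT (A f n t).
Proof.
move=> mf; apply: measurable_funM => //.
apply: measurable_sum => i.
apply: (measurableT_comp (f := fun w => f (iter i tau t, w))) => //.
exact: (measurableT_comp mf (@pair1_measurable _ _ (borel_of M) Omega _)).
Qed.

Let norm_EFK K : `|EFK K| <= K%:R.
Proof.
have bT : @bmfun R _ (borel_of M * Omega)%type (FK K).
  by split; [exact: measurable_truncation|exists K%:R; exact: norm_truncation_le].
have := le_norm_mean (mu \x P)%E bT => /le_trans; apply.
apply: mean_le_cst; first exact: bmfun_norm.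
by move=> z; exact: norm_truncation_le.
Qed.

(** Convexity moves the power inside the average, and each term is below the tail at the shifted
    point. *)
Let avg_tail_le K n t w :
  ((`|A F n t w - A (FK K) n t w| `^ p)%:E <=
   n%:R^-1%:E * \sum_(i < n) tail F p K (theta (cocycle tau kappa i t) w))%E.
Proof.
pose x i := `|F (iter i tau t, theta (cocycle tau kappa i t) w) -
  FK K (iter i tau t, theta (cocycle tau kappa i t) w)|.
have x0 i : 0 <= x i by exact: normr_ge0.
apply: (@le_trans _ _ (n%:R^-1 * \sum_(i < n) x i `^ p)%:E).
  rewrite lee_fin; apply: le_trans (powR_avg_le p1 n x0).
  apply: ge0_ler_powR; rewrite ?nnegrE ?(ltW p0)//.
    by rewrite mulr_ge0 ?invr_ge0// sumr_ge0.
  rewrite /ergodic_avg -mulrBr -sumrB normrM ger0_norm ?invr_ge0//.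
  by rewrite ler_wpM2l ?invr_ge0//; exact: ler_norm_sum.
rewrite EFinM -sumEFin; apply: lee_wpmul2l; first by rewrite lee_fin invr_ge0.
by apply: lee_sum => i _; exact: powR_sub_truncation_le.
Qed.

Let integral_tail_theta K l :
  (\int[P]_w tail F p K (theta l w) = \int[P]_w tail F p K w)%E.
Proof.
have [_ pt _ _ _] := pres.
have := @ge0_integral_pushforward _ _ _ _ R (theta l) (mtheta l) P setT (tail F p K)
  measurableT (measurable_tail p mG K) _.
rewrite preimage_setT => /= <-; last by move=> w _; exact: tail_ge0.
by apply: eq_measure_integral => B mB _; exact: pt.
Qed.

(** The error splits into that of the truncated average, the average of what was cut off, and the
    difference of the two space means; the last two each cost one tail, whatever [n] and [t]. *)
Lemma integral_pow_le K n t : (0 < K)%N -> (0 < n)%N ->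
  (\int[P]_w tail F p K w <= 1)%E ->
  (\int[P]_w (`|A F n t w - EF| `^ p)%:E <=
   (3 `^ p)%:E * (((K + K).+1%:R `^ p)%:E * (\int[P]_w `|A (FK K) n t w - EFK K|)%:E +
     \int[P]_w tail F p K w + \int[P]_w tail F p K w))%E.
Proof.
move=> K0 n0 r1.
(* The truncated error is at most [K + K]; the successor also gives [1 <= L], required by
   [powR_le_linear]. *)
set r := (\int[P]_w tail F p K w)%E; set L : R := (K + K).+1%:R.
have r0 : (0 <= r)%E by apply: integral_ge0 => w _; exact: tail_ge0.
have rfin : r \is a fin_num by exact: integral_tail_fin.
have mFK : measurable_fun [set: (borel_of M * Omega)%type] (FK K) by exact: measurable_truncation.
have mAF := measurable_ergodic_avg n t mF.
have mAK := measurable_ergodic_avg n t mFK.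
have YKL w : `|A (FK K) n t w - EFK K| <= L.
  apply: le_trans (ler_normB _ _) _.
  rewrite /L -natr1 natrD; apply: (@le_trans _ _ (K%:R + K%:R)); last by rewrite lerDl.
  rewrite lerD//.
  apply: (@norm_avg_le _ n (fun i => FK K (iter i tau t, theta (cocycle tau kappa i t) w))) => // i.
  exact: norm_truncation_le.
have bYK : bmfun (fun w => A (FK K) n t w - EFK K).
  by split; [exact: measurable_funB|exists L].
pose q w := (n%:R^-1%:E * \sum_(i < n) tail F p K (theta (cocycle tau kappa i t) w))%E.
have mtl l : measurable_fun setT (fun w => tail F p K (theta l w)).
  by apply: measurableT_comp => //; exact: measurable_tail.
have msum : measurable_fun setT (fun w => \sum_(i < n) tail F p K (theta (cocycle tau kappa i t) w))%E.
  exact: emeasurable_sum.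
have mq : measurable_fun setT q by apply: emeasurable_funM.
have q0 w : (0 <= q w)%E.
  by rewrite mule_ge0 ?lee_fin ?invr_ge0// sume_ge0// => i _; exact: tail_ge0.
(* By invariance of [P] all [n] terms have integral [r], and [n] is nonzero, so the average
   integrates to [r]. *)
have iq : (\int[P]_w q w = r)%E.
  rewrite ge0_integralZl//; last first.
    by move=> w _; apply: sume_ge0 => i _; exact: tail_ge0.
  rewrite ge0_integral_sum//; last by move=> i w _; exact: tail_ge0.
  under eq_bigr do rewrite integral_tail_theta.
  rewrite -/r -(fineK rfin) sumEFin -EFinM sumr_const card_ord -[fine r *+ n]mulr_natl.
  by rewrite mulKf// pnatr_eq0 -lt0n.
have mYK : measurable_fun setT (fun w => `|A (FK K) n t w - EFK K|%:E).
  by apply/measurable_EFinP; have [] := bmfun_norm bYK.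
have iYK : (\int[P]_w (`|A (FK K) n t w - EFK K|)%:E =
    (\int[P]_w `|A (FK K) n t w - EFK K|)%:E)%E.
  by rewrite fineK//; apply: integrable_fin_num => //; exact/bmfun_integrable/bmfun_norm.
apply: (@le_trans _ _ (\int[P]_w ((3 `^ p)%:E *
    ((L `^ p)%:E * (`|A (FK K) n t w - EFK K|)%:E + q w + r)))%E).
  apply: ge0_le_integral => //.
  - apply/measurable_EFinP; apply: (measurableT_comp (measurable_powR _)).
    by apply: measurableT_comp => //; exact: measurable_funB.
  - apply: emeasurable_funM => //; apply: emeasurable_funD => //.
    by apply: emeasurable_funD => //; apply: emeasurable_funM.
  move=> w _.
  apply: (@le_trans _ _ ((3 `^ p * (`|A (FK K) n t w - EFK K| `^ p +
    `|A F n t w - A (FK K) n t w| `^ p + `|EF - EFK K| `^ p))%:E)).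
    rewrite lee_fin; apply: le_trans (powR_add3_le p1 _ _ _) => //.
    apply: ge0_ler_powR; rewrite ?nnegrE ?(ltW p0) ?addr_ge0//.
    rewrite (_ : A F n t w - EF = (A (FK K) n t w - EFK K) + (A F n t w - A (FK K) n t w)
      - (EF - EFK K)); last by ring.
    by apply: le_trans (ler_normB _ _) _; rewrite lerD2r; exact: ler_normD.
  rewrite EFinM; apply: lee_wpmul2l; first by rewrite lee_fin powR_ge0.
  rewrite !EFinD; apply: leeD; first apply: leeD.
  - rewrite -EFinM lee_fin; apply: powR_le_linear => //.
      by rewrite /L ler1n.
    by rewrite normr_ge0 YKL.
  - exact: avg_tail_le.
  - have : `|EF - EFK K| <= fine r by exact: integral_sub_truncation_le.
    rewrite -(fineK rfin) lee_fin => le_r; apply: le_trans le_r.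
    (* A difference of means at most 1 has its [p]-th power below itself, hence below [r]. *)
    have fr1 : fine r <= 1 by rewrite -lee_fin fineK.
    have [->|ne0] := eqVneq `|EF - EFK K| 0; first by rewrite powR0// gt_eqF.
    have le1 : `|EF - EFK K| <= 1.
      by apply: le_trans fr1; exact: integral_sub_truncation_le.
    by apply: ge1r_powR => //; rewrite le1 andbT lt_neqAle eq_sym ne0 normr_ge0.
have c0 : (0 <= (3 `^ p)%:E)%E by rewrite lee_fin powR_ge0.
have L0 : (0 <= (L `^ p)%:E)%E by rewrite lee_fin powR_ge0.
have h1 w : (0 <= (L `^ p)%:E * (`|A (FK K) n t w - EFK K|)%:E)%E.
  by rewrite mule_ge0// lee_fin.
have m1 : measurable_fun setT (fun w => (L `^ p)%:E * (`|A (FK K) n t w - EFK K|)%:E)%E.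
  exact: emeasurable_funM.
have h2 w : (0 <= (L `^ p)%:E * (`|A (FK K) n t w - EFK K|)%:E + q w)%E.
  by rewrite adde_ge0.
have m2 : measurable_fun setT
    (fun w => (L `^ p)%:E * (`|A (FK K) n t w - EFK K|)%:E + q w)%E.
  exact: emeasurable_funD.
have h3 w : (0 <= (L `^ p)%:E * (`|A (FK K) n t w - EFK K|)%:E + q w + r)%E.
  by rewrite adde_ge0.
have m3 : measurable_fun setT
    (fun w => (L `^ p)%:E * (`|A (FK K) n t w - EFK K|)%:E + q w + r)%E.
  exact: emeasurable_funD.
rewrite ge0_integralZl// ge0_integralD// ge0_integralD// ge0_integralZl//.
rewrite iYK iq [X in (_ * (_ + X) <= _)%E](_ : _ = r)//.
rewrite (_ : (fun=> r) = cst r)// integral_cst// [X in (_ * X)%E](_ : _ = 1%E) ?mule1//.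
exact: probability_setT.
Qed.

End unbounded_case.

Theorem theorem4p9 (R : realType) (M : pseudoPMetricType R)
  (dO : measure_display) (Omega : measurableType dO) (P : probability Omega R)
  (d : nat) (tau : M -> M) (mu : probability (borel_of M) R)
  (theta : 'rV[int]_d -> Omega -> Omega) (kappa : M -> 'rV[int]_d) (p : R) :
  hausdorff_space M ->
  compact [set: M] ->
  separable_space M ->
  uniquely_ergodic_with tau mu ->
  preserving_group P theta ->
  strongly_mixing P theta ->
  (forall k, measurable (kappa @^-1` [set k] : set (borel_of M))) ->
  (forall m : nat,
     (fun n : nat => (n%:R ^+ 2)^-1 *
        sup (range (fun t : M => (close_pairs tau kappa m n t)%:R)))
       @ \oo --> (0 : R)) ->
  1 <= p ->
  forall F : M * Omega -> R,
    measurable_fun [set: (borel_of M * Omega)%type] F ->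
    let G : Omega -> \bar R :=
      fun w => ereal_sup (range (fun t : M => (`|F (t, w)|)%:E)) in
    measurable_fun [set: Omega] G ->
    (Lnorm P p%:E G < +oo)%E ->
    {ae P, forall w : Omega, continuous (fun t : M => F (t, w))} ->
    let EF := fine (\int[mu \x P]_z (F z)%:E)%E in
    (fun n : nat =>
       ereal_sup (range (fun t : M =>
         Lnorm P p%:E (fun w : Omega =>
            (ergodic_avg tau theta kappa F n t w - EF)%:E))))
      @ \oo --> 0%E.

Proof.
move=> hM cM _ ue pres mix _ Hclose p1 F mF G mG iG cF EF.
have sp := sparse_cocycle Hclose.
have p0 : 0 < p by exact: lt_le_trans p1.
apply: cvge0_nonneg.
  by move=> n; apply: le_trans (Lnorm_ge0 _ _ _) (ereal_sup_ubound _); exists point.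
move=> e e0.
pose c : R := 3 `^ p; have c0 : 0 < c by rewrite powR_gt0.
(* The bound 1 is the tail condition of [integral_pow_le]; the other lets its three terms, each at
   most [eta] and multiplied by [c], add up to at most the [p]-th power of [e]. *)
pose eta := Num.min 1 (e `^ p / (3 * c)).
have ep0 : 0 < e `^ p by rewrite powR_gt0.
have eta0 : 0 < eta by rewrite lt_min ltr01 divr_gt0// mulr_gt0.
have eta1 : eta <= 1 by rewrite ge_min lexx.
have etae : c * (eta + eta + eta) <= e `^ p.
  have : eta <= e `^ p / (3 * c) by rewrite ge_min lexx orbT.
  by rewrite ler_pdivlMr ?mulr_gt0//; lra.
have [K K0 rK] : exists2 K, (0 < K)%N & (\int[P]_w tail F p K w <= eta%:E)%E.
  have /fine_cvgP[_ /cvgrPdist_le/(_ _ eta0)[N _ HN]] := integral_tail_cvg0 p1 mG iG.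
  exists N.+1 => //; have := HN N.+1 (leqnSn N); rewrite /= sub0r normrN => h.
  by rewrite -(fineK (integral_tail_fin p1 mG iG _)) lee_fin (le_trans (ler_norm _)).
pose L : R := (K + K).+1%:R `^ p; have L0 : 0 < L by rewrite powR_gt0// ltr0n.
(* With [K] fixed first, the accuracy [eta / L] absorbs the factor [L] that comes with the truncated
   average. *)
have [N HN] := bounded_ergodic hM cM ue pres mix sp (measurable_truncation mG K mF)
  (norm_truncation_le F K) (ae_continuous_truncation K cF) (divr_gt0 eta0 L0).
exists N.+1 => n Nn; apply: ge_ereal_sup => _ [t _ <-].
apply: Lnorm_le_of_integral => //.
have n0 : (0 < n)%N by exact: leq_ltn_trans Nn.
have r1 : (\int[P]_w tail F p K w <= 1)%E by apply: le_trans rK _; rewrite lee_fin.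
apply: le_trans (integral_pow_le tau mu kappa pres p1 mF mG iG t K0 n0 r1) _.
have := HN n t (ltnW Nn); rewrite ler_pdivlMr// mulrC => h.
move: rK; rewrite -(fineK (integral_tail_fin p1 mG iG K)) lee_fin => rK.
(* All terms are finite, so the extended real expression is convertible to the image of a real
   one. *)
rewrite -[leLHS]/((c * (L * _ + _ + _))%:E) lee_fin; apply: le_trans etae.
by rewrite ler_pM2l// !lerD.
Qed.
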